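(* For $i=1,2,3$ let $M_i\subseteq\mathcal B(H_i)$ be a von Neumann algebra, and let $\theta_1\colon M_1\to M_2$ and $\theta_2\colon M_2\to M_3$ be normal completely positive maps. Then $V^{\theta_2\circ\theta_1}=V^{\theta_1}\circ V^{\theta_2}$.
   Context: For von Neumann algebras $M\subseteq\mathcal B(H)$, $N\subseteq\mathcal B(K)$ and a normal completely positive map $\theta\colon N\to M$, choose a Hilbert space $L$ and $v\in\mathcal B(H,K\otimes L)$ with $\theta(y)=v^*(y\otimes1)v$ for all $y\in N$, and define $V^\theta=\overline{\mathrm{lin}}^{\,w^*}\{y'(1\otimes\langle\xi|)v:\xi\in L,\ y'\in N'\}\subseteq\mathcal B(H,K)$ (weak$^*$-closed linear span; $\langle\xi|\colon L\to\mathbb C$, $\eta\mapsto(\xi|\eta)$). This is independent of the choice of $(L,v)$, and is a quantum relation from $M$ to $N$, i.e. a weak$^*$-closed $N'$-$M'$-bimodule in $\mathcal B(H,K)$. Thus $V^{\theta_1}\subseteq\mathcal B(H_2,H_1)$ and $V^{\theta_2}\subseteq\mathcal B(H_3,H_2)$. Composition of quantum relations is $V\circ W=\overline{\mathrm{lin}}^{\,w^*}\{vw:v\in V,w\in W\}$. *)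

(* Defs.v *)
From HB Require Import structures.
From mathcomp Require Import all_boot all_order all_algebra.
From mathcomp Require Import sesquilinear complex.
From mathcomp Require Import all_classical all_reals all_analysis.

Set Implicit Arguments.
Unset Strict Implicit.
Unset Printing Implicit Defensive.

Import Order.TTheory GRing.Theory Num.Theory.
Import numFieldNormedType.Exports.

Local Open Scope classical_set_scope.
Local Open Scope ring_scope.

(* The scalars are an arbitrary [C : numClosedFieldType] only because this is
   where MathComp-Analysis puts the topology of the complex numbers; the
   definitions are meant for [C := R[i]] with [R : realType]. *)

(* [dot] forms are linear in their first argument and antilinear in the
   second: the inner product [(x|y)] that is linear in [y] is [dot y x]. *)
HB.mixin Record CompleteNormedModule_isHilbert (C : numClosedFieldType) H
    & CompleteNormedModule C H := {
  dot : {dot H for (@Num.conj C)} ;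
  dotxx : forall x : H, dot x x = `|x| ^+ 2
}.

#[short(type="hilbertType")]
HB.structure Definition Hilbert (C : numClosedFieldType) :=
  {H of CompleteNormedModule C H & CompleteNormedModule_isHilbert C H}.

Arguments dot {C s} : rename.

Definition lin (C : numClosedFieldType) (E : lmodType C) (A : set E) : set E :=
  [set x | exists n (a : 'I_n -> C) (e : 'I_n -> E),
     (forall i, A (e i)) /\ x = \sum_(i < n) a i *: e i].

Section BoundedOperators.
Variables (C : numClosedFieldType) (H K : hilbertType C).

Definition bounded_operator : {pred H -> K} :=
  mem [set f : H -> K | linear f /\ continuous f].

Lemma bounded_operator_submod_closed : submod_closed bounded_operator.
Proof.
split=> [|a f g]; rewrite !inE /=.
  split; first by move=> a x y; rewrite /= scaler0 addr0.
  exact: cst_continuous.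
move=> [lf cf] [lg cg]; split=> [b x y|x].
  change (a *: f (b *: x + y) + g (b *: x + y) =
          b *: (a *: f x + g x) + (a *: f y + g y)).
  by rewrite lf lg !scalerDr !scalerA mulrC addrACA.
change ((fun z => a *: f z + g z) @ x --> a *: f x + g x).
by apply: cvgD; [exact: cvgZl_tmp (cf x)|exact: cg].
Qed.

HB.instance Definition _ :=
  GRing.isSubmodClosed.Build C (H -> K) bounded_operator
    bounded_operator_submod_closed.

Definition bop := {f : H -> K | f \in bounded_operator}.

HB.instance Definition _ := SubChoice.on bop.
HB.instance Definition _ := [SubChoice_isSubLmodule of bop by <:].

Definition bop_fun (f : bop) : H -> K := sval f.

Lemma bop_is_linear (f : bop) : linear (bop_fun f).
Proof. by case: f => f /= /set_mem[]. Qed.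

HB.instance Definition _ (f : bop) :=
  GRing.isLinear.Build C H K *:%R (bop_fun f) (bop_is_linear f).

Lemma bop_continuous (f : bop) : continuous (bop_fun f).
Proof. by case: f => f /= /set_mem[]. Qed.

Definition square_summable (G : hilbertType C) (u : nat -> G) :=
  cvgn (series (fun n => `|u n| ^+ 2)).

Definition normal_index : set ((nat -> H) * (nat -> K)) :=
  [set u | square_summable u.1 /\ square_summable u.2].

(* The functionals [T |-> \sum_n (eta_n | T xi_n)], with [xi] and [eta] square
   summable, are exactly those given by the trace-class operators, i.e., the
   elements of the predual of the bounded operators. *)
Definition normal_functional (u : normal_index) (T : bop) : C :=
  limn (series (fun n => dot (bop_fun T ((val u).1 n)) ((val u).2 n))).

Definition weak_star_eval (T : bop) : {ptws normal_index -> C} :=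
  fun u => normal_functional u T.

(* The canonical topology of [bop] is the weak* topology, not that of the
   operator norm. *)
HB.instance Definition _ :=
  Topological.copy bop (initial_topology weak_star_eval).

End BoundedOperators.

Coercion bop_fun : bop >-> Funclass.

Arguments bounded_operator {C} H K.
Arguments normal_index {C} H K.

Section OperatorAlgebra.
Variable C : numClosedFieldType.
Implicit Types G H K L : hilbertType C.

Lemma bop_id_subproof H : idfun \in bounded_operator H H.
Proof. by rewrite inE /=; split=> // x; exact: cvg_id. Qed.

Definition bop_id H : bop H H := Sub idfun (bop_id_subproof H).

Lemma bop_comp_subproof G H K (v : bop H K) (w : bop G H) :
  v \o w \in bounded_operator G K.
Proof.
rewrite inE /=; split=> [a x y|x]; first by rewrite /= !linearP.
by apply: continuous_comp; exact: bop_continuous.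
Qed.

Definition bop_comp G H K (v : bop H K) (w : bop G H) : bop G K :=
  Sub (v \o w) (bop_comp_subproof v w).

(* The Hilbert space adjoint always exists and is unique, so that the default
   value [0] is never used. *)
Definition adjoint H K (v : bop H K) : bop K H :=
  xget 0 [set w : bop K H | forall x y, dot (v x) y = dot x (w y)].

Definition commutant H (M : set (bop H H)) : set (bop H H) :=
  [set x' | forall x, M x -> bop_comp x' x = bop_comp x x'].

Record von_neumann_algebra H (M : set (bop H H)) : Prop := {
  vn_id : M (bop_id H) ;
  vn_lin : forall a x y, M x -> M y -> M (a *: x + y) ;
  vn_comp : forall x y, M x -> M y -> M (bop_comp x y) ;
  vn_adjoint : forall x, M x -> M (adjoint x) ;
  vn_closed : closed M
}.

Definition positive_mx H n (x : 'M[bop H H]_n) :=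
  forall xi : 'I_n -> H, 0 <= \sum_i \sum_j dot (x i j (xi j)) (xi i).

(* A map between von Neumann algebras N and M is represented by a function on
   all bounded operators, of which only the restriction to N matters. *)
Record normal_cp_map H K (N : set (bop K K)) (M : set (bop H H))
    (theta : bop K K -> bop H H) : Prop := {
  ncp_maps : forall y, N y -> M (theta y) ;
  ncp_linear : forall a x y, N x -> N y ->
    theta (a *: x + y) = a *: theta x + theta y ;
  ncp_positive : forall n (y : 'M[bop K K]_n), (forall i j, N (y i j)) ->
    positive_mx y -> positive_mx (map_mx theta y) ;
  ncp_normal : {within N, continuous theta}
}.

(* These data determine the Hilbert space tensor product up to a unique
   unitary compatible with the elementary tensors. *)
Record hilbert_tensor K L := {
  tensor_space :> hilbertType C ;
  tensor : {bilinear K -> L -> tensor_space} ;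
  dot_tensor : forall k k' l l',
    dot (tensor k l) (tensor k' l') = dot k k' * dot l l' ;
  dense_tensor : dense (lin [set tensor k l | k in setT & l in setT])
}.

(* y (x) 1 and 1 (x) <xi|: in both cases exactly one bounded operator has the
   given values on the elementary tensors. *)
Definition ampliation K L (T : hilbert_tensor K L) (y : bop K K) : bop T T :=
  xget 0 [set Y : bop T T | forall k l, Y (tensor T k l) = tensor T (y k) l].

Definition slice K L (T : hilbert_tensor K L) (xi : L) : bop T K :=
  xget 0 [set S : bop T K | forall k l, S (tensor T k l) = dot l xi *: k].

Record dilation H K (N : set (bop K K)) (theta : bop K K -> bop H H) := {
  dil_space : hilbertType C ;
  dil_tensor : hilbert_tensor K dil_space ;
  dil_op : bop H dil_tensor ;
  dilationE : forall y, N y ->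
    theta y = bop_comp (adjoint dil_op) (bop_comp (ampliation dil_tensor y) dil_op)
}.

(* The quantum relation V^theta, computed from a choice of dilation. *)
Definition quantum_relation H K (N : set (bop K K))
    (theta : bop K K -> bop H H) (D : dilation N theta) : set (bop H K) :=
  closure (lin [set bop_comp y' (bop_comp (slice (dil_tensor D) xi) (dil_op D))
               | y' in commutant N & xi in [set: dil_space D]]).

Definition quantum_comp G H K (V : set (bop H K)) (W : set (bop G H)) :
    set (bop G K) :=
  closure (lin [set bop_comp v w | v in V & w in W]).

End OperatorAlgebra.

(* Main.v *)
Require Import Defs.
From HB Require Import structures.
From mathcomp Require Import all_boot all_order all_algebra.
From mathcomp Require Import sesquilinear complex.
From mathcomp Require Import all_classical all_reals all_analysis.
From mathcomp Require Import ring lra.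

Set Implicit Arguments.
Unset Strict Implicit.
Unset Printing Implicit Defensive.

Import Order.TTheory GRing.Theory Num.Theory.
Import numFieldNormedType.Exports.

Local Open Scope classical_set_scope.
Local Open Scope complex_scope.
Local Open Scope ring_scope.

(** Write [v1], [v2], [v] for the dilating operators of [theta1], [theta2] and
    [theta2 \o theta1], and [pi] for the representation [y |-> y (x) 1] of the
    algebra [M1] on a tensor product [H1 (x) L].

    A quantum relation is the weak* closure of the operators [s v], where [s]
    runs over the bounded intertwiners from [pi] to the identity representation
    of [M1]: compressing such an [s] by [1 (x) p], with [p] a projection of
    finite rank on [L], turns [s v] into a finite sum of operators
    [y' (1 (x) <xi|) v] with [y'] in the commutant, and these compressions
    converge strongly to [s v] while staying bounded
    ([quantum_relationE]).  In this form a relation between two dilations is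
    exhibited by an intertwiner [u] between their spaces, and such a [u] exists
    as soon as one Gram matrix dominates another ([intertwiner_extension]).

    Two intertwiners are needed.  An element [y'] of the commutant of [M2] can be
    moved across [v1], that is, [v1 y' = r v1] for some [r] commuting with [pi],
    because [theta1] takes its values in [M2] ([commutant_lift]).  And for every
    [e] there is [u_e] with [u_e v = v1 (1 (x) <e|) v2] ([slice_factor]).
    Together they show that a product [s v1 y' (1 (x) <e|) v2] is of the form
    [s' v], which gives one inclusion ([quantum_comp_sub_closure]).  For the
    other one, when [e] runs over a finite orthonormal family the sum [A] of the
    [u_e^* u_e] satisfies [0 <= A <= 1] and [A v] tends strongly to [v] as the
    family grows; hence [s v] is the limit of the sums of the
    [(s u_e^* v1) ((1 (x) <e|) v2)] ([intertwined_sub_quantum_comp]).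

    The family [(u_e)] plays the part of the identification of the minimal
    dilation of [theta2 \o theta1] with a subspace of [H1 (x) L1 (x) L2]; that
    triple tensor product is never formed.  The domination behind [u_e]
    is the complete positivity of [theta1], which appears as the inequality
    between a Gram sum over a small and over a large orthonormal family
    ([module_slice_le]); the domination behind [r] comes from an iterated
    Cauchy-Schwarz inequality ([commuting_bound]). *)

(** * Real-valued norms and inner products *)

(** The norm of a module over [R[i]] takes its values in [R[i]], whose order is
    only partial; estimates are carried out on its real part instead. *)
Definition rnorm (R : realType) (V : normedZmodType R[i]) (x : V) : R :=
  complex.Re `|x|.

Section RealNorm.
Variables (R : realType) (V : normedZmodType R[i]).
Implicit Types x y : V.

Lemma rnormE x : `|x| = (rnorm x)%:C.
Proof. by rewrite /rnorm RRe_real. Qed.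

Lemma rnorm_ge0 x : 0 <= rnorm x.
Proof. by rewrite -ler0c -rnormE. Qed.

Lemma rnorm0 : rnorm (0 : V) = 0.
Proof. by rewrite /rnorm normr0. Qed.

Lemma rnorm_eq0 x : rnorm x = 0 -> x = 0.
Proof. by move=> x0; apply/eqP; rewrite -normr_eq0 rnormE x0. Qed.

Lemma rnormN x : rnorm (- x) = rnorm x.
Proof. by rewrite /rnorm normrN. Qed.

Lemma rnormD x y : rnorm (x + y) <= rnorm x + rnorm y.
Proof. by rewrite -lecR rmorphD /= -!rnormE ler_normD. Qed.

Lemma rnormB x y : rnorm (x - y) = rnorm (y - x).
Proof. by rewrite -rnormN opprB. Qed.

Lemma rnorm_sum (I : Type) (r : seq I) (P : pred I) (F : I -> V) :
  rnorm (\sum_(i <- r | P i) F i) <= \sum_(i <- r | P i) rnorm (F i).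
Proof.
elim/big_rec2: _ => [|i y x _ le_xy]; first by rewrite rnorm0.
by rewrite (le_trans (rnormD _ _))// lerD2l.
Qed.

Lemma rnorm_le_dist x y : rnorm x <= rnorm y + rnorm (x - y).
Proof. by rewrite -{1}(subrK y x) addrC rnormD. Qed.

Lemma rnorm_small_eq0 x : (forall e : R, 0 < e -> rnorm x <= e) -> x = 0.
Proof.
move=> xe; apply: rnorm_eq0; apply/eqP; rewrite eq_le rnorm_ge0 andbT.
by apply/ler_addgt0Pr => e e0; rewrite add0r xe.
Qed.

End RealNorm.

Section RealNormScalar.
Variable R : realType.
Implicit Types a b : R[i].

Lemma rnormM a b : rnorm (a * b) = rnorm a * rnorm b.
Proof. by apply: complexI; rewrite rmorphM /= -!rnormE normrM. Qed.

Lemma rnorm_real (c : R) : rnorm c%:C = `|c|.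
Proof. by rewrite /rnorm normc_def /= expr0n /= addr0 sqrtr_sqr. Qed.

Lemma conjC_rc (c : R) : Num.conj (c%:C : R[i]) = c%:C.
Proof. exact: conjc_real. Qed.

Lemma Im_le_rnorm a : `|complex.Im a| <= rnorm a.
Proof.
by rewrite /rnorm normc_def /= -[leLHS]sqrtr_sqr ler_wsqrtr // lerDr sqr_ge0.
Qed.

Lemma norm_Re_le_rnorm a : `|complex.Re a| <= rnorm a.
Proof.
by rewrite /rnorm normc_def /= -[leLHS]sqrtr_sqr ler_wsqrtr // lerDl sqr_ge0.
Qed.

Lemma rnorm_le_ReIm a : rnorm a <= `|complex.Re a| + `|complex.Im a|.
Proof.
rewrite [a in rnorm a]complexE (le_trans (rnormD _ _))// rnormM !rnorm_real.
by rewrite {1}/rnorm normc_def /= expr0n add0r expr1n sqrtr1 mul1r.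
Qed.

Lemma rnormZ (V : normedModType R[i]) a (x : V) :
  rnorm (a *: x) = rnorm a * rnorm x.
Proof. by apply: complexI; rewrite rmorphM /= -!rnormE normrZ. Qed.

End RealNormScalar.

Section InnerProduct.
Variables (R : realType) (H : hilbertType R[i]).
Implicit Types (x y z : H) (a : R[i]).

Lemma dotDl x y z : dot (x + y) z = dot x z + dot y z.
Proof. exact: linearDl. Qed.

Lemma dotDr x y z : dot z (x + y) = dot z x + dot z y.
Proof. exact: linearDr. Qed.

Lemma dotBl x y z : dot (x - y) z = dot x z - dot y z.
Proof. exact: linearBl. Qed.

Lemma dotBr x y z : dot z (x - y) = dot z x - dot z y.
Proof. exact: linearBr. Qed.

Lemma dotZl a x y : dot (a *: x) y = a * dot x y.
Proof. exact: linearZl_LR. Qed.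

Lemma dotZr a x y : dot x (a *: y) = a^* * dot x y.
Proof. exact: linearZr_LR. Qed.

Lemma dot0l x : dot 0 x = 0. Proof. exact: linear0l. Qed.

Lemma dot0r x : dot x 0 = 0. Proof. exact: linear0r. Qed.

Lemma dotC x y : dot x y = (dot y x)^*.
Proof. by rewrite (hermC (dot : {dot H for Num.conj})) expr0 mul1r. Qed.

Lemma dot_suml (I : Type) (r : seq I) (P : pred I) (F : I -> H) y :
  dot (\sum_(i <- r | P i) F i) y = \sum_(i <- r | P i) dot (F i) y.
Proof. exact: linear_sumlz. Qed.

Lemma dot_sumr (I : Type) (r : seq I) (P : pred I) (F : I -> H) y :
  dot y (\sum_(i <- r | P i) F i) = \sum_(i <- r | P i) dot y (F i).
Proof. exact: linear_sumr. Qed.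

Lemma dot_self x : dot x x = (rnorm x ^+ 2)%:C.
Proof. by rewrite dotxx rnormE rmorphXn. Qed.

Lemma rnorm_gt0 x : x != 0 -> 0 < rnorm x.
Proof.
by move=> x0; rewrite lt_def rnorm_ge0 andbT; apply: contraNneq x0 => /rnorm_eq0 ->.
Qed.

(** The left-hand side is a square, so this identity contains the Cauchy-Schwarz
    inequality; it also measures how far [x] is from minimizing its distance to
    a subspace containing [y]. *)
Lemma rnorm_sub_proj x y : y != 0 ->
  rnorm (x - (dot x y / dot y y) *: y) ^+ 2 =
  rnorm x ^+ 2 - rnorm (dot x y) ^+ 2 / rnorm y ^+ 2.
Proof.
move=> y0; have yy0 : dot y y != 0.
  rewrite dot_self -[0]/(0%:C) (inj_eq (@complexI _)) expf_neq0// gt_eqF//.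
  exact: rnorm_gt0.
apply: complexI; rewrite -dot_self rmorphB fmorph_div /= -!dot_self.
set c := dot x y / _.
have -> : (rnorm (dot x y) ^+ 2)%:C = dot x y * (dot x y)^*.
  by rewrite -normCK rnormE rmorphXn.
rewrite dotBl !dotBr dotZl !dotZr !dotZl.
have -> : c * dot y y = dot x y by rewrite /c divfK.
rewrite (dotC y x) /c; ring.
Qed.

Lemma rnorm_dot x y : rnorm (dot x y) <= rnorm x * rnorm y.
Proof.
have [->|y0] := eqVneq y 0; first by rewrite dot0r !rnorm0 mulr0.
have := sqr_ge0 (rnorm (x - (dot x y / dot y y) *: y)).
rewrite rnorm_sub_proj// subr_ge0 ler_pdivrMr ?exprn_gt0 ?rnorm_gt0// -exprMn.
by rewrite ler_sqr// ?nnegrE ?mulr_ge0 ?rnorm_ge0.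
Qed.

Lemma rnorm_sqD_orth x y : dot x y = 0 ->
  rnorm (x + y) ^+ 2 = rnorm x ^+ 2 + rnorm y ^+ 2.
Proof.
move=> xy0; apply: complexI; rewrite rmorphD /= -!dot_self dotDl !dotDr.
by rewrite (dotC y x) xy0 conjC0 addr0 add0r.
Qed.

Lemma dot_inj x y : (forall z, dot x z = dot y z) -> x = y.
Proof.
move=> xy; apply/subr0_eq/rnorm_eq0/eqP.
rewrite -sqrf_eq0 -(inj_eq (@complexI _)) -dot_self dotBl xy.
by rewrite subrr.
Qed.

End InnerProduct.

(** * Bounded operators *)

Section BoundedOps.
Variable R : realType.
Implicit Types H K : hilbertType R[i].

Lemma bop_bound H K (f : bop H K) :
  exists2 c : R, 0 < c & forall x, rnorm (f x) <= c * rnorm x.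
Proof.
have [_ /(_ (@bop_continuous _ _ _ f))] := linear_bounded_continuous f.
move=> /linear_boundedP/pinfty_ex_gt0[r r0 fr].
have rE : r = (complex.Re r)%:C by rewrite RRe_real// gtr0_real.
exists (complex.Re r); first by rewrite -ltcR -rE; exact: r0.
by move=> x; rewrite -lecR rmorphM /= -!rnormE -rE; exact: fr.
Qed.

Lemma bounded_operatorP H K (f : H -> K) (c : R) :
  linear f -> (forall x, rnorm (f x) <= c * rnorm x) ->
  f \in bounded_operator H K.
Proof.
move=> lf fc; rewrite inE; split=> //.
pose g : {linear H -> K} := HB.pack f (GRing.isLinear.Build _ _ _ _ f lf).
apply: (@bounded_linear_continuous _ _ _ g); apply/linear_boundedP.
exists c%:C; split; first by apply/complex_realP; exists c.
move=> r cr x; rewrite (@le_trans _ _ (c%:C * `|x|))//.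
  by rewrite !rnormE -rmorphM lecR fc.
by rewrite ler_wpM2r// ltW.
Qed.

Lemma bop_eq H K (f g : bop H K) : (forall x, f x = g x) -> f = g.
Proof. by move=> fg; apply/val_inj/funext. Qed.

(** Total linear relations with a bound are the graphs of bounded operators:
    boundedness makes them single-valued. *)
Lemma bop_of_rel H K (G : H -> K -> Prop) (c : R) :
  (forall x, exists y, G x y) ->
  (forall (a : R[i]) x x' y y', G x y -> G x' y' -> G (a *: x + x') (a *: y + y')) ->
  (forall x y, G x y -> rnorm y <= c * rnorm x) ->
  exists f : bop H K, forall x y, G x y <-> f x = y.
Proof.
move=> /choice[f fG] Glin Gc.
have Guniq x y y' : G x y -> G x y' -> y = y'.
  move=> /(Glin (-1) _ _ _ _) /[apply]; rewrite !scaleN1r !addNr => /Gc.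
  rewrite rnorm0 mulr0 => yy; apply/eqP; rewrite eq_sym -subr_eq0 addrC; apply/eqP.
  by apply: rnorm_eq0; apply/eqP; rewrite eq_le yy rnorm_ge0.
have lf : linear f by move=> a x y; apply: Guniq (fG _) _; exact: Glin.
exists (Sub f (bounded_operatorP lf (fun x => Gc _ _ (fG x)))) => x y.
by split=> [|<-]; [exact: Guniq|exact: fG].
Qed.

End BoundedOps.

Section BopModule.
Variables (R : realType) (H K : hilbertType R[i]).

Lemma bop_sumE (I : Type) (r : seq I) (P : pred I) (F : I -> bop H K) x :
  (\sum_(i <- r | P i) F i : bop H K) x = \sum_(i <- r | P i) F i x.
Proof. by elim/big_rec2: _ => [|i y f _ <-]. Qed.

Lemma bopZ (f : bop H K) (a : R[i]) x : f (a *: x) = a *: f x.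
Proof. exact: linearZ. Qed.

Lemma bopD (f : bop H K) x y : f (x + y) = f x + f y.
Proof. exact: linearD. Qed.

Lemma bopB (f : bop H K) x y : f (x - y) = f x - f y.
Proof. exact: linearB. Qed.

Lemma bop_sum (f : bop H K) (I : Type) (r : seq I) (P : pred I) (F : I -> H) :
  f (\sum_(i <- r | P i) F i) = \sum_(i <- r | P i) f (F i).
Proof. exact: linear_sum. Qed.

End BopModule.

Lemma bop_compA (R : realType) (G H K L : hilbertType R[i]) (a : bop K L) (b : bop H K)
    (c : bop G H) : bop_comp a (bop_comp b c) = bop_comp (bop_comp a b) c.
Proof. exact: bop_eq. Qed.

Lemma bop_compPl (R : realType) (G H K : hilbertType R[i]) (a : R[i]) (f g : bop H K)
    (h : bop G H) :
  bop_comp (a *: f + g) h = a *: bop_comp f h + bop_comp g h.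
Proof. exact: bop_eq. Qed.

Lemma bop_compPr (R : realType) (G H K : hilbertType R[i]) (a : R[i]) (f g : bop G H)
    (h : bop H K) :
  bop_comp h (a *: f + g) = a *: bop_comp h f + bop_comp h g.
Proof.
apply: bop_eq => x; rewrite -[LHS]/(h (a *: f x + g x)).
by rewrite -[RHS]/(a *: h (f x) + h (g x)) bopD bopZ.
Qed.

(** * Linear subspaces and orthogonal projection *)

Section Subspaces.
Variables (R : realType) (E : lmodType R[i]).
Implicit Types A B : set E.

Definition linear_subspace A :=
  A 0 /\ forall (a : R[i]) x y, A x -> A y -> A (a *: x + y).

Lemma subspaceD A x y : linear_subspace A -> A x -> A y -> A (x + y).
Proof. by move=> [_ Al] Ax Ay; rewrite -[x]scale1r; exact: Al. Qed.

Lemma subspaceZ A (a : R[i]) x : linear_subspace A -> A x -> A (a *: x).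
Proof. by move=> [A0 Al] Ax; rewrite -[_ *: _]addr0; exact: Al. Qed.

Lemma subspace_sum A (I : Type) (r : seq I) (P : pred I) (F : I -> E) :
  linear_subspace A -> (forall i, P i -> A (F i)) -> A (\sum_(i <- r | P i) F i).
Proof.
move=> sA AF; elim/big_ind: _ => //; first exact: sA.1.
by move=> x y; exact: subspaceD.
Qed.

Lemma sub_lin A : A `<=` lin A.
Proof.
move=> x Ax; exists 1%N, (fun=> 1), (fun=> x); split=> //.
by rewrite big_ord1 scale1r.
Qed.

Lemma lin_sub A B : linear_subspace B -> A `<=` B -> lin A `<=` B.
Proof.
move=> sB AB _ [n [a [e [Ae ->]]]]; apply: subspace_sum => // i _.
by apply: subspaceZ => //; exact/AB/Ae.
Qed.

Lemma subspace_linS A : linear_subspace (lin A).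
Proof.
split; first by exists 0%N, (fun=> 0), (fun=> 0); split=> [[]//|]; rewrite big_ord0.
move=> c x y [n [a [e [Ae ->]]]] [m [b [f [Af ->]]]].
exists (n + m)%N, (fun i : 'I_(n + m) => match fintype.split i with
    inl j => c * a j | inr k => b k end),
  (fun i : 'I_(n + m) => match fintype.split i with inl j => e j | inr k => f k end).
split; first by move=> i; case: fintype.split.
rewrite big_split_ord /= scaler_sumr; congr (_ + _); apply: eq_bigr => i _.
  by rewrite (unsplitK (inl i)) scalerA.
by rewrite (unsplitK (inr i)).
Qed.

End Subspaces.

Section Completeness.
Variables (R : realType) (H : hilbertType R[i]).

Lemma seq_inv_small (e : R) : 0 < e ->
  exists N, forall n, (N <= n)%N -> n.+1%:R^-1 < e.
Proof.
move=> e0; have [N _ NP] := near_infty_natSinv_lt (PosNum e0).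
by exists N => n Nn; exact: NP.
Qed.

Lemma rnorm_complete (u : nat -> H) :
  (forall e : R, 0 < e -> exists N, forall m n, (N <= m)%N -> (N <= n)%N ->
    rnorm (u m - u n) < e) ->
  exists l, forall e : R, 0 < e -> exists N, forall n, (N <= n)%N ->
    rnorm (l - u n) < e.
Proof.
move=> uC; have : cvg (u @ \oo).
  apply/cauchy_cvgP/cauchyP => e e0.
  have eE : e = (complex.Re e)%:C by rewrite RRe_real// gtr0_real.
  have [|N uN] := uC (complex.Re e); first by rewrite -ltcR -eE.
  exists (u N); exists N => // n /= Nn.
  by rewrite -ball_normE /= rnormE eE ltcR uN.
move=> /cvgrPdist_lt ul; exists (lim (u @ \oo)) => e e0.
have [|N _ uN] := ul e%:C; first by rewrite ltcR.
by exists N => n Nn; have := uN n Nn; rewrite rnormE ltcR.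
Qed.

Definition adherent (A : set H) (x : H) :=
  forall e : R, 0 < e -> exists2 y, A y & rnorm (x - y) < e.

(** Almost minimizing the distance to a subspace makes the difference almost
    orthogonal to it; this gives both that a minimizing sequence is Cauchy and
    that its limit is the orthogonal projection. *)
Lemma orthogonal_projection (E : set H) (x : H) : linear_subspace E ->
  exists p, adherent E p /\ forall e, E e -> dot (x - p) e = 0.
Proof.
move=> [E0 Elin].
pose S := [set rnorm (x - e) ^+ 2 | e in E].
have Sinf : has_inf S.
  split; first by exists (rnorm (x - 0) ^+ 2); exists 0.
  by exists 0 => _ [e _ <-]; exact: sqr_ge0.
have dle e : E e -> inf S <= rnorm (x - e) ^+ 2.
  by move=> Ee; apply: ge_inf; [exact: Sinf.2|exists e].
have near_orth (eta : R) e e' : 0 < eta -> E e -> E e' ->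
    rnorm (x - e) ^+ 2 < inf S + eta ^+ 2 ->
    rnorm (dot (x - e) e') <= eta * rnorm e'.
  move=> eta0 Ee Ee' xe.
  have [->|e'0] := eqVneq e' 0; first by rewrite dot0r !rnorm0 mulr0.
  have := dle _ (Elin (dot (x - e) e' / dot e' e') _ _ Ee' Ee).
  have -> (z : H) : x - (z + e) = (x - e) - z by rewrite opprD addrA addrAC.
  rewrite rnorm_sub_proj// => dx.
  have ne' : 0 < rnorm e' by exact: rnorm_gt0.
  have {dx}: rnorm (dot (x - e) e') ^+ 2 / rnorm e' ^+ 2 <= eta ^+ 2 by lra.
  rewrite ler_pdivrMr ?exprn_gt0// -exprMn ler_sqr// nnegrE ?rnorm_ge0//.
  by rewrite mulr_ge0// ltW.
have ex_u n : exists e, E e /\ rnorm (x - e) ^+ 2 < inf S + (n.+1%:R^-1) ^+ 2.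
  have [|_ [e Ee <-] lte] := @inf_adherent _ _ (n.+1%:R^-1 ^+ 2 : R) _ Sinf.
    by rewrite exprn_gt0.
  by exists e.
have [u uP] := choice ex_u.
have [e e0|p pP] := @rnorm_complete u.
  have [|N NP] := @seq_inv_small (e / 2); first by rewrite divr_gt0.
  exists N => m n Nm Nn; set f := u m - u n.
  have Ef : E f.
    rewrite /f addrC -scaleN1r; apply: Elin; [exact: (uP n).1|exact: (uP m).1].
  have [->|f0] := eqVneq f 0; first by rewrite rnorm0.
  have nf := rnorm_gt0 f0.
  have h1 := @near_orth m.+1%:R^-1 (u m) f (ltac:(by [])) (uP m).1 Ef (uP m).2.
  have h2 := @near_orth n.+1%:R^-1 (u n) f (ltac:(by [])) (uP n).1 Ef (uP n).2.
  have fE : dot f f = dot (x - u n) f - dot (x - u m) f.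
    by rewrite -dotBl; congr (dot _ f); rewrite opprB addrC addrA subrK.
  have : rnorm f ^+ 2 <= rnorm (dot (x - u n) f) + rnorm (dot (x - u m) f).
    rewrite -[rnorm f ^+ 2]ger0_norm ?sqr_ge0// -rnorm_real -dot_self fE.
    by rewrite (le_trans (rnormD _ _))// rnormN.
  have ae := NP m Nm; have be := NP n Nn => cg.
  have : rnorm f * rnorm f <= (m.+1%:R^-1 + n.+1%:R^-1) * rnorm f.
    by rewrite -expr2 mulrDl (le_trans cg)// addrC lerD.
  by rewrite ler_pM2r//; move: ae be; move: m.+1%:R^-1 n.+1%:R^-1 => a b; lra.
exists p; split=> [e e0|e Ee].
  by have [N NP] := pP _ e0; exists (u N); [exact: (uP N).1|exact: NP].
apply: rnorm_small_eq0 => d d0.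
have d1 : 0 < d / (1 + rnorm e) / 2 by rewrite !divr_gt0// ltr_wpDr ?rnorm_ge0.
have [N1 N1P] := pP _ d1; have [N2 N2P] := seq_inv_small d1.
pose n := maxn N1 N2.
have := @near_orth n.+1%:R^-1 _ _ (ltac:(by [])) (uP n).1 Ee (uP n).2.
have := N1P n (leq_maxl _ _); have := N2P n (leq_maxr _ _).
move=> h1 h2 h3.
have -> : x - p = (x - u n) - (p - u n) by rewrite opprB addrA subrK.
rewrite dotBl (le_trans (rnormD _ _))// rnormN.
have h4 := rnorm_dot (p - u n) e.
have dE : d / (1 + rnorm e) * (1 + rnorm e) = d.
  by rewrite divfK// gt_eqF// ltr_wpDr ?rnorm_ge0.
have e0 := rnorm_ge0 e.
move: (d / _) dE d1 h1 h2 => q dE q0 h1 h2.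
have : rnorm (p - u n) * rnorm e <= q / 2 * rnorm e by rewrite ler_wpM2r// ltW.
have : n.+1%:R^-1 * rnorm e <= q / 2 * rnorm e by rewrite ler_wpM2r// ltW.
by move: (_^-1 * _) h3 => t; lra.
Qed.

End Completeness.

(** * Adjoints and extension of partially defined operators *)

Section Adjoints.
Variable R : realType.
Implicit Types H K X Y : hilbertType R[i].

Lemma riesz H (g : H -> R[i]) (c : R) :
  (forall a x y, g (a *: x + y) = a * g x + g y) ->
  (forall x, rnorm (g x) <= c * rnorm x) ->
  exists w, forall x, g x = dot x w.
Proof.
move=> glin gc; pose E := [set x | g x = 0].
have g0 : g 0 = 0.
  apply: rnorm_eq0; apply/eqP.
  by rewrite eq_le rnorm_ge0 (le_trans (gc 0))// rnorm0 mulr0.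
have sE : linear_subspace E.
  by split=> // a x y; rewrite /E/= glin => -> ->; rewrite mulr0 addr0.
have [gE|/existsNP[x0 gx0]] := pselect (forall x, g x = 0).
  by exists 0 => x; rewrite gE dot0r.
have [p [pE px0]] := orthogonal_projection x0 sE.
have gB x y : g (x - y) = g x - g y.
  by rewrite addrC -scaleN1r glin mulN1r addrC.
have gZ a x : g (a *: x) = a * g x by rewrite -[a *: x]addr0 glin g0 addr0.
have gp : g p = 0.
  apply: rnorm_small_eq0 => e e0.
  have [|q gq pq] := pE (e / (1 + `|c|)); first by rewrite divr_gt0// ltr_wpDr.
  have -> : g p = g (p - q) by rewrite gB gq subr0.
  rewrite (le_trans (gc _))// (@le_trans _ _ ((1 + `|c|) * rnorm (p - q)))//.
    by rewrite ler_wpM2r ?rnorm_ge0// (le_trans (ler_norm _))// lerDr.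
  by rewrite mulrC -ler_pdivlMr ?ltW// ltr_wpDr.
pose z := x0 - p.
have gz : g z != 0 by rewrite gB gp subr0; apply/eqP.
have zz : dot z z != 0.
  apply: contra gz; rewrite dot_self -[0]/(0%:C) (inj_eq (@complexI _)) sqrf_eq0.
  by move=> /eqP/rnorm_eq0 ->; rewrite g0.
(* [z] spans the orthogonal complement of the kernel of [g]; the coefficient is
   the one for which both sides agree at [z]. *)
exists ((g z / dot z z)^* *: z) => x.
have xz : dot x z = g x / g z * dot z z.
  have /px0 : E (x - (g x / g z) *: z).
    by rewrite /E/= gB gZ divfK// subrr.
  rewrite -/z dotC dotBl dotZl => /(canRL (@conjCK _)).
  by rewrite conjC0 => /subr0_eq.
rewrite dotZr conjCK xz; field.
by rewrite gz zz.
Qed.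

(** The adjoint is single-valued and bounded because [|w|^2 = (v w|y)] whenever
    [w] represents the functional [x |-> (v x|y)]. *)
Lemma adjointP H K (v : bop H K) x y : dot (v x) y = dot x (adjoint v y).
Proof.
suff : exists w : bop K H, forall x y, dot (v x) y = dot x (w y).
  by move=> vw; have /(_ x y) := xgetPex 0 vw.
have [c c0 vc] := bop_bound v.
have [|||w wP] := @bop_of_rel _ K H (fun y w => forall x, dot (v x) y = dot x w) c.
- move=> {}y; have [||w] := @riesz H (fun x => dot (v x) y) (c * rnorm y).
  + by move=> a x1 x2; rewrite linearP dotDl dotZl.
  + move=> x1; rewrite (le_trans (rnorm_dot _ _))// mulrAC ler_wpM2r ?rnorm_ge0//.
  by exists w.
- by move=> a y1 y2 w1 w2 h1 h2 x1; rewrite !dotDr !dotZr h1 h2.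
- move=> {}y w vw; have [->|w0] := eqVneq w 0.
    by rewrite rnorm0 mulr_ge0 ?rnorm_ge0// ltW.
  have := vw w => /(congr1 (@rnorm _ _)).
  rewrite dot_self rnorm_real ger0_norm ?sqr_ge0//.
  move=> /esym E; have := rnorm_dot (v w) y; rewrite -E expr2.
  move=> /le_trans /(_ (ler_wpM2r (rnorm_ge0 y) (vc w))).
  by rewrite mulrAC ler_pM2r ?rnorm_gt0.
by exists w => x1 y1; have /wP := erefl (w y1); exact.
Qed.

Lemma adjointPr H K (v : bop H K) x y : dot x (v y) = dot (adjoint v x) y.
Proof. by rewrite dotC adjointP -dotC. Qed.

Lemma adjoint_uniq H K (v : bop H K) (w : bop K H) :
  (forall x y, dot (v x) y = dot x (w y)) -> adjoint v = w.
Proof.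
move=> vw; apply: bop_eq => y; apply: dot_inj => x.
by rewrite -adjointPr dotC vw -dotC.
Qed.

Lemma adjointK H K (v : bop H K) : adjoint (adjoint v) = v.
Proof. by apply: adjoint_uniq => x y; rewrite -adjointPr. Qed.

Lemma adjoint_comp H K X (v : bop H K) (w : bop X H) :
  adjoint (bop_comp v w) = bop_comp (adjoint w) (adjoint v).
Proof. by apply: adjoint_uniq => x y; rewrite /= !adjointP. Qed.

Lemma adjoint_bound H K (v : bop H K) (c : R) : 0 <= c ->
  (forall x, rnorm (v x) <= c * rnorm x) ->
  forall y, rnorm (adjoint v y) <= c * rnorm y.
Proof.
move=> c0 vc y; have [->|w0] := eqVneq (adjoint v y) 0.
  by rewrite rnorm0 mulr_ge0 ?rnorm_ge0.
have := adjointP v (adjoint v y) y.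
move=> /(congr1 (@rnorm _ _)); rewrite dot_self rnorm_real ger0_norm ?sqr_ge0//.
move=> E; have := rnorm_dot (v (adjoint v y)) y; rewrite E expr2.
move=> /le_trans /(_ (ler_wpM2r (rnorm_ge0 y) (vc _))).
by rewrite mulrAC ler_pM2r ?rnorm_gt0.
Qed.

End Adjoints.

Section Extension.
Variable R : realType.
Implicit Types H K X Y : hilbertType R[i].

Lemma adherent_orth H (E : set H) (p r : H) : adherent E p ->
  (forall e, E e -> dot r e = 0) -> dot r p = 0.
Proof.
move=> pE rE; apply: rnorm_small_eq0 => d d0.
have [|e Ee pe] := pE (d / (1 + rnorm r)).
  by rewrite divr_gt0// ltr_wpDr ?rnorm_ge0.
have -> : dot r p = dot r (p - e) by rewrite dotBr (rE e)// subr0.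
rewrite (le_trans (rnorm_dot _ _))// mulrC.
rewrite (@le_trans _ _ (rnorm (p - e) * (1 + rnorm r)))//.
  by rewrite ler_wpM2l ?rnorm_ge0// lerDr.
by rewrite -ler_pdivlMr ?ltW// ltr_wpDr ?rnorm_ge0.
Qed.

Lemma rnorm_projection_le H (x p : H) : dot (x - p) p = 0 -> rnorm p <= rnorm x.
Proof.
move=> /rnorm_sqD_orth; rewrite subrK => xE.
rewrite -[_ <= _](@ler_sqr _ (rnorm p)) ?nnegrE ?rnorm_ge0// xE.
by rewrite lerDr sqr_ge0.
Qed.

(** A bounded linear relation [G] extends by continuity to the closure of its
    domain [E], and by zero to the orthogonal complement of [E].  The resulting
    operator intertwines [p] and [q] as soon as [G] is invariant under them and
    [E] under [p^*], since then [p] preserves the complement of [E]. *)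
Lemma bop_extend X Y (G : X -> Y -> Prop) (c : R) : 0 <= c ->
  G 0 0 ->
  (forall (a : R[i]) x x' y y', G x y -> G x' y' -> G (a *: x + x') (a *: y + y')) ->
  (forall x y, G x y -> rnorm y <= c * rnorm x) ->
  exists u : bop X Y, [/\ forall x y, G x y -> u x = y,
    forall x, (forall e f, G e f -> dot x e = 0) -> u x = 0 &
    forall (p : bop X X) (q : bop Y Y),
      (forall x y, G x y -> G (p x) (q y)) ->
      (forall x y, G x y -> exists z, G (adjoint p x) z) ->
      forall x, u (p x) = q (u x)].
Proof.
move=> c0 G0 Glin Gc.
pose E := [set x | exists y, G x y].
have sE : linear_subspace E.
  by split=> [|a x x' [y xy] [y' xy']]; [exists 0|exists (a *: y + y'); exact: Glin].
pose lim_of p y := forall e : R, 0 < e -> exists x' y',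
  [/\ G x' y', rnorm (p - x') < e & rnorm (y - y') < e].
pose Rl x y := exists p, (forall e, E e -> dot (x - p) e = 0) /\ lim_of p y.
have GB x x' y y' : G x y -> G x' y' -> G (x - x') (y - y').
  move=> h h'; rewrite addrC [y - _]addrC -(scaleN1r x') -(scaleN1r y').
    exact: Glin.
(* [Rl x y]: the projection [p] of [x] on the closure of [E] and [y] form a limit
   of pairs in [G]. *)
have [|||u uP] := @bop_of_rel _ X Y Rl c.
- move=> x; have [p [pE xp]] := orthogonal_projection x sE.
  have /choice[w wP] n : exists w : X * Y, G w.1 w.2 /\ rnorm (p - w.1) < n.+1%:R^-1.
    by have [//|e [f ef] pe] := pE n.+1%:R^-1; exists (e, f).
  have [e e0|y yP] := @rnorm_complete _ Y (fun n => (w n).2).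
    have [|N NP] := @seq_inv_small R (e / (1 + c) / 2).
      by rewrite !divr_gt0// ltr_wpDr.
    exists N => m n Nm Nn; apply: le_lt_trans (Gc _ _ (GB _ _ _ _ (wP m).1 (wP n).1)) _.
    have -> : (w m).1 - (w n).1 = (p - (w n).1) - (p - (w m).1).
      by rewrite opprB [RHS]addrC addrA subrK.
    have := rnormD (p - (w n).1) (- (p - (w m).1)); rewrite rnormN.
    have := (wP n).2; have := (wP m).2; have := NP _ Nm; have := NP _ Nn.
    set d := e / (1 + c) => h1 h2 h3 h4 h5.
    have dE : d * (1 + c) = e by rewrite /d divfK// gt_eqF// ltr_wpDr.
    have {}h5 : rnorm (p - (w n).1 - (p - (w m).1)) < d.
      rewrite (le_lt_trans h5)// [ltRHS]splitr ltrD//.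
        exact: lt_trans h4 h1.
      exact: lt_trans h3 h2.
    apply: (@le_lt_trans _ _ (c * d)); first by rewrite ler_wpM2l// ltW.
    by rewrite -dE mulrDr mulr1 mulrC ltrDr divr_gt0// ltr_wpDr.
  exists y, p; split=> // e e0.
  have [N NP] := yP _ e0; have [N' N'P] := seq_inv_small e0.
  exists (w (maxn N N')).1, (w (maxn N N')).2; split; first exact: (wP _).1.
    by apply: lt_trans (wP _).2 _; apply: N'P; exact: leq_maxr.
  by apply: NP; exact: leq_maxl.
- move=> a x x' y y' [p [xp py]] [p' [xp' py']]; exists (a *: p + p'); split.
    move=> e Ee; have -> : a *: x + x' - (a *: p + p') = a *: (x - p) + (x' - p').
      by rewrite scalerBr opprD addrACA.
    by rewrite dotDl dotZl xp// xp'// mulr0 addr0.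
  move=> e e0; have a0 := rnorm_ge0 a.
  have d0 : 0 < e / (1 + rnorm a) by rewrite divr_gt0// ltr_wpDr.
  have dE : e / (1 + rnorm a) * (1 + rnorm a) = e by rewrite divfK// gt_eqF// ltr_wpDr.
  have [z [t [zt pz yt]]] := py _ d0; have [z' [t' [zt' pz' yt']]] := py' _ d0.
  have comb (V : hilbertType R[i]) (v v' s s' : V) :
      rnorm (v - s) < e / (1 + rnorm a) -> rnorm (v' - s') < e / (1 + rnorm a) ->
      rnorm (a *: v + v' - (a *: s + s')) < e.
    move=> h h'; have -> : a *: v + v' - (a *: s + s') = a *: (v - s) + (v' - s').
      by rewrite scalerBr opprD addrACA.
    rewrite (le_lt_trans (rnormD _ _))// rnormZ -[ltRHS]dE mulrDr mulr1 addrC ltr_leD//.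
    by rewrite mulrC ler_wpM2r// ltW.
  exists (a *: z + z'), (a *: t + t'); split; first exact: Glin.
    exact: comb.
  exact: comb.
- move=> x y [p [xp py]].
  have pE : adherent E p.
    by move=> e /py[z [t [zt pz _]]]; exists z => //; exists t.
  have px : rnorm p <= rnorm x.
    by apply: rnorm_projection_le; exact: adherent_orth pE xp.
  apply/ler_addgt0Pr => e e0.
  have d0 : 0 < e / (1 + c) by rewrite divr_gt0// ltr_wpDr.
  have dE : e / (1 + c) * (1 + c) = e by rewrite divfK// gt_eqF// ltr_wpDr.
  have [z [t [zt pz yt]]] := py _ d0.
  have h1 := rnorm_le_dist y t; have h2 := Gc _ _ zt.
  have h3 := rnorm_le_dist z p; rewrite (rnormB z) in h3.
  have h4 : c * rnorm z <= c * (rnorm x + e / (1 + c)).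
    by rewrite ler_wpM2l// (le_trans h3)// lerD// ltW.
  rewrite (le_trans h1)// -[in leRHS]dE mulrDr mulr1 addrA [leRHS]addrAC.
  by rewrite lerD ?(ltW yt)// (le_trans h2)// (le_trans h4)// mulrDr (mulrC c (e / _)).
have Gu x y : G x y -> u x = y.
  move=> xy; apply/uP; exists x; split; first by move=> e _; rewrite subrr dot0l.
  by move=> e e0; exists x, y; split=> //; rewrite subrr rnorm0.
exists u; split=> //.
  move=> x xG; apply/uP; exists 0; split.
    by move=> e [f ef]; rewrite subr0 (xG e f).
  by move=> e e0; exists 0, 0; split=> //; rewrite subrr rnorm0.
move=> p q Gpq Gp x; have /uP[x' [xx' x'u]] := erefl (u x).
apply/uP; exists (p x'); split.
  by move=> e [f /Gp[z Gz]]; rewrite -linearB adjointP xx'//; exists z.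
move=> e e0; have [a a0 pa] := bop_bound p; have [b b0 qb] := bop_bound q.
have [|z [t [zt xz ut]]] := x'u (e / (a + b)); first by rewrite divr_gt0// addr_gt0.
exists (p z), (q t); split; first exact: Gpq.
- rewrite -linearB (le_lt_trans (pa _))//.
  rewrite -(@ltr_pM2l _ a) in xz => //; apply: lt_le_trans xz _.
  by rewrite mulrC -mulrA ler_piMr ?ltW// mulrC ltr_pdivrMr ?addr_gt0// mul1r ltrDl.
- rewrite -linearB (le_lt_trans (qb _))//.
  rewrite -(@ltr_pM2l _ b) in ut => //; apply: lt_le_trans ut _.
  by rewrite mulrC -mulrA ler_piMr ?ltW// mulrC ltr_pdivrMr ?addr_gt0// mul1r ltrDr.
Qed.

(** The quotients [q k = f k / (g * c ^ (2 ^ k))] satisfy [q k ^ 2 <= q k.+1] and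
    are bounded by [C / g]; if [q 0] exceeded [1], they would grow like
    [q 0 ^ (2 ^ k)]. *)
Lemma iterated_square_bound (f : nat -> R) (g c C : R) : 0 <= g -> 0 < c ->
  (forall k, 0 <= f k) ->
  (forall k, f k ^+ 2 <= f k.+1 * g) -> (forall k, f k <= C * c ^+ (2 ^ k)%N) ->
  f 0%N <= c * g.
Proof.
move=> g0 c0 f0 fg fC.
have [gE|gn] := eqVneq g 0.
  have := fg 0%N; rewrite gE !mulr0 => h.
  have /eqP : f 0%N ^+ 2 = 0 by apply/eqP; rewrite eq_le h sqr_ge0.
  by rewrite sqrf_eq0 => /eqP ->.
have gp : 0 < g by rewrite lt_def gn.
pose q k := f k / (g * c ^+ (2 ^ k)).
have den k : 0 < g * c ^+ (2 ^ k) by rewrite mulr_gt0 ?exprn_gt0.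
have q0 k : 0 <= q k by rewrite divr_ge0// ltW.
have qS k : q k ^+ 2 <= q k.+1.
  rewrite /q expr_div_n ler_pdivrMr ?exprn_gt0//.
  have -> : f k.+1 / (g * c ^+ (2 ^ k.+1)) * (g * c ^+ (2 ^ k)) ^+ 2 = f k.+1 * g.
    rewrite expnS mulnC exprM; field.
    by rewrite gn expf_neq0// gt_eqF.
  exact: fg.
have qX k : q 0%N ^+ (2 ^ k) <= q k.
  elim: k => [|k IHk]; first by rewrite expn0 expr1.
  rewrite expnS mulnC exprM (le_trans _ (qS k))//.
  by rewrite ler_sqr ?nnegrE ?exprn_ge0.
have qC k : q k <= C / g.
  rewrite /q ler_pdivrMr// mulrA divfK//.
suff : q 0%N <= 1.
  by rewrite /q ler_pdivrMr// mul1r expn0 expr1 mulrC.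
rewrite leNgt; apply/negP => q1.
pose t := q 0%N - 1; have t0 : 0 < t by rewrite subr_gt0.
have tX n : 1 + n%:R * t <= q 0%N ^+ n.
  elim: n => [|n IHn]; first by rewrite expr0 mul0r addr0.
  rewrite exprS -[q 0%N](subrK 1) -/t -natr1.
  have n0 : 0 <= n%:R * t by rewrite mulr_ge0// ltW.
  rewrite -[q 0%N](subrK 1) -/t in IHn.
  apply: (@le_trans _ _ ((t + 1) * (1 + n%:R * t))); last first.
    by rewrite ler_wpM2l// addr_ge0// ltW.
  have -> : (t + 1) * (1 + n%:R * t) = 1 + (n%:R + 1) * t + n%:R * t * t by ring.
  by rewrite lerDl mulr_ge0// ltW.
(* [N.+1 * t > C / g] and [N.+1 <= 2 ^ N], so that Bernoulli's inequality [tX]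
   brings [q N] above its bound. *)
pose N := Num.truncn (C / g / t).
have := qC N; apply/negP; rewrite -ltNge.
apply: lt_le_trans (qX N); apply: lt_le_trans (tX _).
rewrite ltr_wpDl// -ltr_pdivrMr//.
apply: lt_le_trans (truncnS_gt _) _; rewrite ler_nat -/N.
exact: ltn_expl.
Qed.

(** An operator that moves to its adjoint across the Gram matrix of the [B i]
    acts diagonally without exceeding its norm bound.  One Cauchy-Schwarz step
    bounds the square for [b = a^* a] by the product of the values for [b ^ 2]
    and for the identity; iterating it removes the constant, depending on the
    [B i], of the crude estimate. *)
Lemma commuting_bound H X n (B : 'I_n -> bop H X) (a : bop H H) (c : R) :
  0 < c -> (forall x, rnorm (a x) <= c * rnorm x) ->
  (forall i j h h', dot (B i (a h)) (B j h') = dot (B i h) (B j (adjoint a h'))) ->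
  forall h : 'I_n -> H,
    rnorm (\sum_i B i (a (h i))) <= c * rnorm (\sum_i B i (h i)).
Proof.
move=> c0 ac Ba h.
pose P (k : 'I_n -> H) := \sum_i B i (k i).
have PaE k k' : dot (P (a \o k)) (P k') = dot (P k) (P (adjoint a \o k')).
  rewrite /P !dot_suml; apply: eq_bigr => i _; rewrite !dot_sumr.
  by apply: eq_bigr => j _; exact: Ba.
have PaE' k k' : dot (P (adjoint a \o k)) (P k') = dot (P k) (P (a \o k')).
  by rewrite dotC -PaE -dotC.
pose b := bop_comp (adjoint a) a.
have PbE k k' : dot (P (b \o k)) (P k') = dot (P k) (P (b \o k')).
  by rewrite (PaE' (a \o k)) PaE.
have PbXE m k k' : dot (P (iter m b \o k)) (P k') = dot (P k) (P (iter m b \o k')).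
  elim: m k k' => [//|m IHm] k k'.
  rewrite (_ : iter m.+1 b \o k = b \o (iter m b \o k))// PbE IHm.
  by congr (dot _ (P _)); apply/funext => i /=; rewrite -iterSr.
have bc x : rnorm (b x) <= c ^+ 2 * rnorm x.
  rewrite (le_trans (adjoint_bound (ltW c0) ac _))// expr2 -mulrA.
  by rewrite ler_wpM2l ?ac// ltW.
have bXc m x : rnorm (iter m b x) <= (c ^+ 2) ^+ m * rnorm x.
  elim: m => [|m IHm]; first by rewrite expr0 mul1r.
  rewrite iterS (le_trans (bc _))// [_ ^+ m.+1]exprS -mulrA ler_wpM2l//.
  by rewrite exprn_ge0// ltW.
have [d d0 dB] : exists2 d : R, 0 <= d & forall i x, rnorm (B i x) <= d * rnorm x.
  have /choice[d dP] i : exists d : R, 0 < d /\ forall x, rnorm (B i x) <= d * rnorm x.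
    by have [d d0 dB] := bop_bound (B i); exists d.
  exists (\sum_i d i); first by apply: sumr_ge0 => i _; rewrite ltW// (dP i).1.
  move=> i x; rewrite (le_trans ((dP i).2 x))// ler_wpM2r ?rnorm_ge0//.
  by rewrite (bigD1 i)//= lerDl; apply: sumr_ge0 => j _; rewrite ltW// (dP j).1.
have step : rnorm (P (iter 1 b \o h)) <= c ^+ 2 * rnorm (P h).
  have := (@iterated_square_bound (fun k => rnorm (P (iter (2 ^ k)%N b \o h)))
      (rnorm (P h)) (c ^+ 2)
      (\sum_i d * rnorm (h i))); rewrite expn0; apply.
  - exact: rnorm_ge0.
  - by rewrite exprn_gt0.
  - by move=> k; exact: rnorm_ge0.
  - move=> k; rewrite -[X in X <= _]ger0_norm ?sqr_ge0// -rnorm_real -dot_self.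
    rewrite -PbXE (le_trans _ (rnorm_dot _ _))//.
    rewrite (_ : _ \o (_ \o _) = iter (2 ^ k.+1)%N b \o h)//.
    by apply/funext => i /=; rewrite expnS mul2n -addnn iterD.
  - move=> k; rewrite (le_trans (rnorm_sum _ _ _))// mulr_suml ler_sum// => i _.
    by rewrite (le_trans (dB _ _))// -mulrA ler_wpM2l// mulrC bXc.
rewrite -/(P (a \o h)) -/(P h).
rewrite -ler_sqr ?nnegrE ?mulr_ge0 ?rnorm_ge0 ?(ltW c0)//.
rewrite -[X in X <= _]ger0_norm ?sqr_ge0// -rnorm_real -dot_self -PaE'.
rewrite (le_trans (rnorm_dot _ _))// exprMn [X in _ <= _ * X]expr2 mulrA.
by rewrite ler_wpM2r ?rnorm_ge0.
Qed.

(** The form in which [bop_extend] is applied: the linear relation generated by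
    the vectors [(B h, B' h)] inherits its invariance from the family [Om] of
    pairs [(B, B')]. *)
Lemma extend_family H X Y (Om : set (bop H X * bop H Y)) (c : R) : 0 <= c ->
  (forall n (B : 'I_n -> bop H X * bop H Y) (h : 'I_n -> H),
    (forall i, Om (B i)) ->
    rnorm (\sum_i (B i).2 (h i)) <= c * rnorm (\sum_i (B i).1 (h i))) ->
  exists u : bop X Y, [/\ forall B h, Om B -> u (B.1 h) = B.2 h,
    forall x, (forall B h, Om B -> dot x (B.1 h) = 0) -> u x = 0 &
    forall (p : bop X X) (q : bop Y Y),
      (forall B, Om B -> Om (bop_comp p B.1, bop_comp q B.2)) ->
      (forall B, Om B -> exists C, Om (bop_comp (adjoint p) B.1, C)) ->
      forall x, u (p x) = q (u x)].
Proof.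
move=> c0 Omc.
pose G x y := exists n (B : 'I_n -> bop H X * bop H Y) (h : 'I_n -> H),
  [/\ forall i, Om (B i), x = \sum_i (B i).1 (h i) & y = \sum_i (B i).2 (h i)].
have G1 B h : Om B -> G (B.1 h) (B.2 h).
  by move=> OmB; exists 1%N, (fun=> B), (fun=> h); rewrite !big_ord1.
have [|a _ _ _ _ [n [B [h [OmB -> ->]]]] [m [B' [h' [OmB' -> ->]]]]
     |_ _ [n [B [h [OmB -> ->]]]]|u [uG uorth uint]] := @bop_extend X Y G c c0.
- have B0 : 'I_0 -> bop H X * bop H Y by case.
  by exists 0%N, B0, (fun=> 0); rewrite !big_ord0; split=> // -[].
- exists (n + m)%N, (fun i : 'I_(n + m) => match fintype.split i with
      inl j => B j | inr j => B' j end),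
    (fun i : 'I_(n + m) => match fintype.split i with
      inl j => a *: h j | inr j => h' j end).
  split; first by move=> i; case: fintype.split.
    rewrite big_split_ord /= scaler_sumr; congr (_ + _); apply: eq_bigr => i _;
      by rewrite ?(unsplitK (inl i)) ?(unsplitK (inr i)) ?bopZ.
  rewrite big_split_ord /= scaler_sumr; congr (_ + _); apply: eq_bigr => i _;
    by rewrite ?(unsplitK (inl i)) ?(unsplitK (inr i)) ?bopZ.
- exact: Omc.
exists u; split.
- by move=> B h OmB; apply/uG/G1.
- move=> x xB; apply: uorth => _ _ [n [B [h [OmB -> _]]]].
  by rewrite dot_sumr big1// => i _; exact: xB.
- move=> p q Opq Op; apply: uint.
    move=> _ _ [n [B [h [OmB -> ->]]]].
    exists n, (fun i => (bop_comp p (B i).1, bop_comp q (B i).2)), h.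
    by split; [move=> i; exact: Opq|rewrite bop_sum|rewrite bop_sum].
  move=> _ _ [n [B [h [OmB -> _]]]].
  have /choice[D DP] i := Op _ (OmB i).
  exists (\sum_i D i (h i)), n, (fun i => (bop_comp (adjoint p) (B i).1, D i)), h.
  by split=> //; rewrite bop_sum.
Qed.

End Extension.

(** * Hilbert tensor products *)

Section Tensor.
Variables (R : realType) (K L : hilbertType R[i]) (T : hilbert_tensor K L).
Local Notation "k ⊗ l" := (tensor T k l) (at level 40).

Lemma rnorm_tensor k l : rnorm (k ⊗ l) = rnorm k * rnorm l.
Proof.
apply/eqP; rewrite -(@eqrXn2 _ 2) ?mulr_ge0 ?rnorm_ge0//; apply/eqP/complexI.
by rewrite -dot_self dot_tensor !dot_self -rmorphM /= exprMn.
Qed.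

Lemma ket_subproof l : (fun k => k ⊗ l) \in bounded_operator K T.
Proof.
apply: (@bounded_operatorP _ _ _ _ (rnorm l)); last first.
  by move=> k; rewrite rnorm_tensor mulrC.
by move=> a x y; rewrite linearPl.
Qed.

(** The operator [1 (x) |l>], whose adjoint is [slice T l]. *)
Definition ket l : bop K T := Sub (fun k => k ⊗ l) (ket_subproof l).

Lemma ketE l k : ket l k = k ⊗ l. Proof. by []. Qed.

(** The density of the elementary tensors, in metric form. *)
Lemma tensor_adherent (z : T) :
  adherent (lin [set k ⊗ l | k in setT & l in setT]) z.
Proof.
move=> e e0; have [||y [yz ly]] := @dense_tensor _ _ _ T (ball z e%:C).
- by exists z; apply: ballxx; rewrite ltcR.
- by apply: ball_open; rewrite ltcR.
by exists y => //; move: yz; rewrite -ball_normE /= rnormE ltcR.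
Qed.

Lemma tensor_ext X (f g : bop T X) :
  (forall k l, f (k ⊗ l) = g (k ⊗ l)) -> f = g.
Proof.
move=> fg; apply: bop_eq => z; apply/subr0_eq/rnorm_small_eq0 => e e0.
have [c c0 hc] := bop_bound (f - g).
have [|y ly zy] := tensor_adherent z (e := e / c); first by rewrite divr_gt0.
have hy : (f - g : bop T X) y = 0.
  case: ly => n [a [w [hw ->]]]; rewrite bop_sum big1// => i _.
  rewrite bopZ; have [k _ [l _ <-]] := hw i.
  have fgkl : (f - g : bop T X) (k ⊗ l) = f (k ⊗ l) - g (k ⊗ l) by [].
  by rewrite fgkl fg subrr scaler0.
have -> : f z - g z = (f - g : bop T X) (z - y) by rewrite bopB hy subr0.
by rewrite (le_trans (hc _))// mulrC -ler_pdivlMr// ltW.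
Qed.

(** Boundedness of [a (x) 1] on the algebraic tensor product is the case of
    [commuting_bound] in which the [B i] are kets. *)
Lemma ampliationE (a : bop K K) k l : ampliation T a (k ⊗ l) = a k ⊗ l.
Proof.
suff : exists Y : bop T T, forall k l, Y (k ⊗ l) = a k ⊗ l.
  by move=> ex; have /(_ k l) := xgetPex 0 ex.
have [c c0 ac] := bop_bound a.
pose Om : set (bop K T * bop K T) := [set (ket l, bop_comp (ket l) a) | l in setT].
have [n B h OmB|Y [YG _ _]] := @extend_family _ _ _ _ Om c (ltW c0).
  have /choice[l1 l1P] i : exists l, B i = (ket l, bop_comp (ket l) a).
    by have [l2 _ <-] := OmB i; exists l2.
  under eq_bigr do rewrite l1P; under [X in _ <= _ * rnorm X]eq_bigr do rewrite l1P.
  apply: (@commuting_bound _ _ _ _ (fun i => ket (l1 i)) a c) => // i j k1 k2.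
  by rewrite !ketE !dot_tensor adjointP.
by exists Y => k1 l1; apply: (YG (ket l1, bop_comp (ket l1) a) k1); exists l1.
Qed.

Lemma sliceE l k l' : slice T l (k ⊗ l') = dot l' l *: k.
Proof.
suff : exists S : bop T K, forall k l', S (k ⊗ l') = dot l' l *: k.
  by move=> ex; have /(_ k l') := xgetPex 0 ex.
exists (adjoint (ket l)) => {}k {}l'; apply: dot_inj => k'.
by rewrite -adjointPr ketE dot_tensor dotZl mulrC.
Qed.

Lemma slice_adj l : slice T l = adjoint (ket l).
Proof.
apply: tensor_ext => k l'; rewrite sliceE; apply: dot_inj => k'.
by rewrite -adjointPr ketE dot_tensor dotZl mulrC.
Qed.

Lemma ampliation_ket a l k : ampliation T a (ket l k) = ket l (a k).
Proof. exact: ampliationE. Qed.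

Lemma ampliation_comp a b :
  ampliation T (bop_comp a b) = bop_comp (ampliation T a) (ampliation T b).
Proof. by apply: tensor_ext => k l; rewrite /= !ampliationE. Qed.

Lemma ampliation_id : ampliation T (bop_id K) = bop_id T.
Proof. by apply: tensor_ext => k l; rewrite ampliationE. Qed.

Lemma slice_ampliation a l :
  bop_comp (slice T l) (ampliation T a) = bop_comp a (slice T l).
Proof. by apply: tensor_ext => k l'; rewrite /= ampliationE !sliceE bopZ. Qed.

Lemma ampliation_adjoint a : ampliation T (adjoint a) = adjoint (ampliation T a).
Proof.
apply: tensor_ext => k l; rewrite ampliationE -!ketE.
have /(congr1 (@adjoint _ _ _)) := slice_ampliation a l.
rewrite !adjoint_comp slice_adj adjointK => /(congr1 (fun f : bop K T => f k)).
by move=> /= ->.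
Qed.

End Tensor.

(** * Finite orthonormal families *)

Section Orthonormal.
Variables (R : realType) (L : hilbertType R[i]).
Implicit Types (s t : seq L) (x y e : L).

(** For orthonormal [t] this says that [x] lies in the span of [t], with the only
    possible coefficients. *)
Definition spanned_by t x := x = \sum_(e <- t) dot x e *: e.

Lemma orthonormal_dot t : orthonormal dot t ->
  {in t &, forall e f, dot e f = (e == f)%:R}.
Proof. by move=> /orthonormalP[]. Qed.

Lemma orthonormal_uniq t : orthonormal dot t -> uniq t.
Proof. by move=> /orthonormalP[]. Qed.

Lemma orthonormal_pick (V : lmodType R[i]) t e (F : L -> V) :
  orthonormal dot t -> e \in t -> \sum_(f <- t) dot f e *: F f = F e.
Proof.
move=> ot et; rewrite (bigD1_seq e)//=; last exact: orthonormal_uniq.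
rewrite (orthonormal_dot ot)// eqxx scale1r big_seq_cond big1 ?addr0// => f.
by move=> /andP[ft fe]; rewrite (orthonormal_dot ot)// (negbTE fe) scale0r.
Qed.

Lemma spanned_by_coef t x (c : L -> R[i]) :
  orthonormal dot t -> x = \sum_(e <- t) c e *: e -> spanned_by t x.
Proof.
move=> ot xE; rewrite /spanned_by {1}xE; apply: eq_big_seq => e et.
congr (_ *: _); rewrite xE dot_suml.
under eq_bigr do rewrite dotZl mulrC.
exact: esym (@orthonormal_pick R[i]^o _ _ c ot et).
Qed.

Lemma spanned_by_cat s t x :
  orthonormal dot (s ++ t) -> spanned_by t x -> spanned_by (s ++ t) x.
Proof.
move=> ost xt.
apply: (@spanned_by_coef _ _ (fun e => if e \in t then dot x e else 0)) => //.
rewrite big_cat /= [X in X + _]big1_seq ?add0r; last first.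
  move=> e /= es; have := orthonormal_uniq ost.
  rewrite cat_uniq => /and3P[_ /hasPn nt _].
  case: ifPn => [/nt|]; last by rewrite scale0r.
  by rewrite /= es.
by rewrite {1}xt; apply: eq_big_seq => e ->.
Qed.

(** The process starts from a given orthonormal family, so that a family can be
    enlarged without changing its members. *)
Lemma gram_schmidt t s : orthonormal dot t ->
  exists t', orthonormal dot (t' ++ t) /\ {in s, forall x, spanned_by (t' ++ t) x}.
Proof.
move=> ot; elim: s => [|x s [t' [ot' t's]]]; first by exists [::].
pose r := x - \sum_(e <- t' ++ t) dot x e *: e.
have rt e : e \in t' ++ t -> dot r e = 0.
  move=> et; rewrite dotBl dot_suml.
  under eq_bigr do rewrite dotZl mulrC.
  by rewrite (@orthonormal_pick R[i]^o _ _ (dot x))// subrr.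
have [r0|r0] := eqVneq r 0.
  exists t'; split=> // y; rewrite inE => /predU1P[->|]; last exact: t's.
  exact/subr0_eq.
have nr := rnorm_gt0 r0.
pose e0 := ((rnorm r)^-1)%:C *: r.
have e0e0 : dot e0 e0 = 1.
  rewrite dotZl dotZr dot_self -[Num.conj _]/(conjc _) conjc_real -!rmorphM /=.
  by rewrite -[1]/(1%:C) mulrA -expr2 -exprMn mulVf ?expr1n// gt_eqF.
have e0t e : e \in t' ++ t -> dot e0 e = 0.
  by move=> et; rewrite dotZl rt// mulr0.
have ot0 : orthonormal dot ((e0 :: t') ++ t).
  apply/orthonormalP; split=> /=.
    rewrite (orthonormal_uniq ot') andbT; apply/negP => /e0t.
    by rewrite e0e0 => /eqP; rewrite oner_eq0.
  move=> e f; rewrite !inE => /predU1P[->|et] /predU1P[->|ft].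
  - by rewrite e0e0 eqxx.
  - rewrite e0t//; case: eqVneq ft => // <- /e0t.
    by rewrite e0e0 => /eqP; rewrite oner_eq0.
  - rewrite dotC e0t// conjC0; case: eqVneq et => // -> /e0t.
    by rewrite e0e0 => /eqP; rewrite oner_eq0.
  - by have -> := orthonormal_dot ot' et ft.
exists (e0 :: t'); split=> // y; rewrite inE => /predU1P[->|ys].
  apply: (@spanned_by_coef _ _
    (fun e => if e == e0 then (rnorm r)%:C else dot x e)) => //.
  rewrite /= big_cons eqxx scalerA -rmorphM /= divff ?gt_eqF// scale1r.
  rewrite (_ : \sum_(e <- _) _ = \sum_(e <- t' ++ t) dot x e *: e) ?subrK//.
  apply: eq_big_seq => e /e0t; case: eqVneq => // ->; rewrite e0e0 => /eqP.
  by rewrite oner_eq0.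
by apply: (@spanned_by_cat [:: e0]) => //; exact: t's.
Qed.

End Orthonormal.

Section SliceProjection.
Variables (R : realType) (K L : hilbertType R[i]) (T : hilbert_tensor K L).
Local Notation "k ⊗ l" := (tensor T k l) (at level 40).
Implicit Types (t : seq L) (z : T).

(** The projection [1 (x) p], with [p] onto the span of an orthonormal [t]. *)
Definition slice_proj t : bop T T :=
  \sum_(e <- t) bop_comp (ket T e) (slice T e).

Lemma slice_projE t z : slice_proj t z = \sum_(e <- t) slice T e z ⊗ e.
Proof. by rewrite bop_sumE. Qed.

Lemma slice_slice_proj t e z : orthonormal dot t -> e \in t ->
  slice T e (slice_proj t z) = slice T e z.
Proof.
move=> ot et; rewrite slice_projE bop_sum.
under eq_bigr do rewrite sliceE.
exact: (orthonormal_pick (fun f => slice T f z)).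
Qed.

Lemma slice_proj_spanned t k l : spanned_by t l -> slice_proj t (k ⊗ l) = k ⊗ l.
Proof.
move=> lt; rewrite slice_projE [in RHS]lt linear_sumr; apply: eq_bigr => e _.
by rewrite sliceE linearZl_LR linearZr_LR.
Qed.

Lemma dot_slice_proj t (F : L -> K) z :
  dot z (\sum_(e <- t) F e ⊗ e) = \sum_(e <- t) dot (slice T e z) (F e).
Proof.
rewrite dot_sumr; apply: eq_bigr => e _.
by rewrite slice_adj -adjointPr.
Qed.

Lemma slice_proj_orth t z : orthonormal dot t ->
  dot (z - slice_proj t z) (slice_proj t z) = 0.
Proof.
move=> ot; rewrite {2}slice_projE dot_slice_proj big_seq big1// => e et.
by rewrite bopB slice_slice_proj// subrr dot0l.
Qed.

Lemma slice_projC_le t z : orthonormal dot t ->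
  rnorm (z - slice_proj t z) <= rnorm z.
Proof.
move=> ot; apply: rnorm_projection_le; rewrite opprB addrC subrK.
by rewrite dotC slice_proj_orth// conjC0.
Qed.

(** Strong convergence of [slice_proj t] to the identity: an algebraic tensor is
    fixed once [t] spans its second factors, and [1 - slice_proj t] is a
    contraction. *)
Lemma slice_proj_approx t (s : seq T) (d : R) : orthonormal dot t -> 0 < d ->
  exists t', orthonormal dot (t' ++ t) /\
    {in s, forall z, rnorm (z - slice_proj (t' ++ t) z) < d}.
Proof.
move=> ot d0.
(* Strengthened so that the estimate survives the enlargements made for the other
   vectors of [s]. *)
suff [t' [ot' t's]] : exists t', orthonormal dot (t' ++ t) /\
    {in s, forall z t'', orthonormal dot (t'' ++ (t' ++ t)) ->
       rnorm (z - slice_proj (t'' ++ (t' ++ t)) z) < d}.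
  by exists t'; split=> // z zs; exact: (t's _ zs [::]).
elim: s => [|z s [t1 [ot1 t1s]]]; first by exists [::].
have [y ly zy] := tensor_adherent z d0.
have [ls lsP] : exists ls : seq L, forall t2, {in ls, forall l, spanned_by t2 l} ->
    slice_proj t2 y = y.
  case: ly => n [a [w [hw ->]]].
  have /choice[kl klP] i : exists kl : K * L, w i = kl.1 ⊗ kl.2.
    by have [k _ [l _ <-]] := hw i; exists (k, l).
  exists [seq (kl i).2 | i <- enum 'I_n] => t2 t2s.
  rewrite bop_sum; apply: eq_bigr => i _; rewrite bopZ klP slice_proj_spanned//.
  by apply: t2s; apply: map_f; rewrite mem_enum.
have [t2 [ot2 t2ls]] := gram_schmidt ls ot1.
exists (t2 ++ t1); rewrite -catA; split=> // x; rewrite inE => /predU1P[->|xs] t3 ot3.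
  have yE : slice_proj (t3 ++ t2 ++ t1 ++ t) y = y.
    by apply: lsP => l /t2ls; exact: spanned_by_cat.
  have -> : z - slice_proj (t3 ++ t2 ++ t1 ++ t) z =
      (z - y) - slice_proj (t3 ++ t2 ++ t1 ++ t) (z - y).
    by rewrite bopB yE opprB addrA subrK.
  exact: le_lt_trans (slice_projC_le _ ot3) zy.
by rewrite catA; apply: t1s => //; rewrite -catA.
Qed.

End SliceProjection.

(** * The weak* topology *)

Section ComplexSequences.
Variable R : realType.
(* The topology of the complex numbers is attached to the coercion to sorts of
   [numClosedFieldType], not to the type [R[i]] itself. *)
Local Notation C := (R[i] : numClosedFieldType).

Lemma rnorm_cvgP (V : normedModType R[i]) (u : nat -> V) (l : V) :
  u @ \oo --> l <->
  forall e : R, 0 < e -> exists N, forall n, (N <= n)%N -> rnorm (l - u n) < e.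
Proof.
split=> [/cvgrPdist_lt ul e e0|ul].
  have [|N _ uN] := ul e%:C; first by rewrite ltcR.
  by exists N => n Nn; have := uN n Nn; rewrite rnormE ltcR.
apply/cvgrPdist_lt => e e0.
have eE : e = (complex.Re e)%:C by rewrite RRe_real// gtr0_real.
have [|N uN] := ul (complex.Re e); first by rewrite -ltcR -eE.
by exists N => // n /= Nn; rewrite rnormE eE ltcR uN.
Qed.

Lemma real_cauchy_cvg (u : nat -> R) :
  (forall e : R, 0 < e -> exists N, forall m n, (N <= m)%N -> (N <= n)%N ->
    `|u m - u n| < e) -> cvg (u @ \oo).
Proof.
move=> uC; apply/cauchy_cvgP/cauchyP => e e0.
have [N NP] := uC _ e0; exists (u N), N => // n /= Nn.
by rewrite -ball_normE /= NP.
Qed.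

(** The tail estimate is what makes normal functionals uniformly approximable by
    finite sums on bounded sets of operators. *)
Lemma dominated_series_cvg (a : nat -> C) (p : nat -> R) (c P : R) :
  0 <= c -> (forall n, rnorm (a n) <= c * p n) -> series p @ \oo --> P ->
  exists l : C, series a @ \oo --> l /\
    forall N, rnorm (l - series a N) <= c * (P - series p N).
Proof.
move=> c0 ap pP.
have tail m n : (m <= n)%N ->
    rnorm (series a n - series a m) <= c * (series p n - series p m).
  move=> mn; rewrite !sub_series_geq// mulr_sumr (le_trans (rnorm_sum _ _ _))//.
  exact: ler_sum.
have p_ge0 n : 0 <= c * p n by rewrite (le_trans (rnorm_ge0 _) (ap n)).
have tailP m n : (m <= n)%N -> rnorm (series a n - series a m) <= c * (P - series p m).
  move=> mn; rewrite (le_trans (tail _ _ mn))// !mulrBr lerD2r.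
  have <- : limn (fun k => c * series p k) = c * P by apply/cvg_lim => //; exact: cvgMr.
  apply: nondecreasing_cvgn_le; last by apply: cvgP; exact: cvgMr pP.
  apply/nondecreasing_seqP => k; rewrite /series/= big_nat_recr//= mulrDr.
  by rewrite lerDl.
have aC (e : R) : 0 < e -> exists N, forall m n, (N <= m)%N -> (N <= n)%N ->
    rnorm (series a m - series a n) < e.
  move=> e0; have /cvgrPdist_lt/(_ (e / 2 / (1 + c))) := pP.
  case=> [|N _ NP]; first by rewrite !divr_gt0// ltr_wpDr.
  have d0 : 0 < e / 2 by rewrite divr_gt0.
  have small : c * (P - series p N) < e / 2.
    have := NP N (leqnn _) => /= /ltr_normlW; rewrite ltr_pdivlMr ?ltr_wpDr// => h.
    have [Pp|Pp] := leP (P - series p N) 0.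
      by apply: le_lt_trans d0; rewrite mulr_ge0_le0.
    by apply: lt_trans h; rewrite mulrC ltr_pM2l// ltrDr.
  exists N => m n Nm Nn.
  have -> : series a m - series a n =
      (series a m - series a N) - (series a n - series a N).
    by rewrite opprB addrA subrK.
  rewrite (le_lt_trans (rnormD _ _))// rnormN [ltRHS]splitr.
  by rewrite ltrD// (le_lt_trans (tailP _ _ _)).
have ReC : cvg ((@complex.Re R \o series a) @ \oo).
  apply: real_cauchy_cvg => e /aC[N NP]; exists N => m n Nm Nn.
  by rewrite /= -raddfB (le_lt_trans (norm_Re_le_rnorm _))// NP.
have ImC : cvg ((@complex.Im R \o series a) @ \oo).
  apply: real_cauchy_cvg => e /aC[N NP]; exists N => m n Nm Nn.
  by rewrite /= -raddfB (le_lt_trans (Im_le_rnorm _))// NP.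
pose l : C := (lim ((@complex.Re R \o series a) @ \oo) +i*
  lim ((@complex.Im R \o series a) @ \oo))%C.
have al : series a @ \oo --> l.
  apply/rnorm_cvgP => e e0; have e20 : 0 < e / 2 by rewrite divr_gt0.
  have /cvgrPdist_lt/(_ _ e20)[N _ NP] := ReC.
  have /cvgrPdist_lt/(_ _ e20)[M _ MP] := ImC.
  exists (maxn N M) => n; rewrite geq_max => /andP[Nn Mn].
  rewrite (le_lt_trans (rnorm_le_ReIm _))// !raddfB [ltRHS]splitr ltrD//.
    exact: NP.
  exact: MP.
exists l; split=> // N; apply/ler_addgt0Pr => e e0.
have /rnorm_cvgP/(_ _ e0)[M MP] := al.
have := MP (maxn N M) (leq_maxr _ _).
have := tailP N (maxn N M) (leq_maxl _ _).
set s := series a (maxn N M) => h1 h2.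
have -> : l - series a N = (s - series a N) + (l - s) by rewrite [RHS]addrC addrA subrK.
by rewrite (le_trans (rnormD _ _))// lerD// ltW.
Qed.

End ComplexSequences.

Lemma square_summableP (R : realType) (G : hilbertType R[i]) (w : nat -> G) :
  square_summable w <-> cvg (series (fun n => rnorm (w n) ^+ 2) @ \oo).
Proof.
have wE n : series (fun n => `|w n| ^+ 2) n =
    (series (fun n => rnorm (w n) ^+ 2) n)%:C.
  rewrite /series /= rmorph_sum; apply: eq_bigr => i _.
  by rewrite rnormE rmorphXn.
split=> /cvg_ex[l wl]; apply/cvg_ex.
  exists (complex.Re l); apply/cvgrPdist_lt => e.
  have /rnorm_cvgP wl' := wl; move=> /wl'[N NP]; exists N => // n /= /NP.
  apply: le_lt_trans; rewrite wE (le_trans _ (norm_Re_le_rnorm _))//.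
  by rewrite raddfB.
exists (l%:C : (R[i] : numClosedFieldType)); apply/rnorm_cvgP => e e0.
have /cvgrPdist_lt/(_ _ e0)[N _ NP] := wl.
by exists N => n Nn; rewrite wE -rmorphB rnorm_real; exact: NP.
Qed.

Section NormalFunctional.
Variables (R : realType) (H K : hilbertType R[i]).
Implicit Types (T S : bop H K) (u : normal_index H K).

(** By the inequality between means, this dominates up to a norm bound of [T] the
    terms [dot (T xi_n) eta_n] of a normal functional. *)
Definition sq_norms u (n : nat) : R :=
  rnorm ((val u).1 n) ^+ 2 + rnorm ((val u).2 n) ^+ 2.

Lemma sq_norms_cvg u : cvg (series (sq_norms u) @ \oo).
Proof.
have [/square_summableP u1 /square_summableP u2] := set_valP u.
have -> : sq_norms u =
    (fun n => rnorm ((val u).1 n) ^+ 2) + (fun n => rnorm ((val u).2 n) ^+ 2).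
  by apply/funext.
by rewrite seriesD; exact: is_cvgD.
Qed.

Lemma rnorm_dot_sq_norms (x : H) (y : K) T (c : R) : 0 <= c ->
  (forall z, rnorm (T z) <= c * rnorm z) ->
  rnorm (dot (T x) y) <= c * (rnorm x ^+ 2 + rnorm y ^+ 2).
Proof.
move=> c0 Tc; rewrite (le_trans (rnorm_dot _ _))//.
rewrite (le_trans (ler_wpM2r (rnorm_ge0 y) (Tc x)))// -mulrA ler_wpM2l//.
have := sqr_ge0 (rnorm x - rnorm y); have := rnorm_ge0 x; have := rnorm_ge0 y.
move: (rnorm x) (rnorm y) => a b b0 a0; rewrite sqrrB => h.
have := mulr_ge0 a0 b0; rewrite -mulr_natr in h; lra.
Qed.

Lemma normal_functional_approx u T (c : R) : 0 <= c ->
  (forall z, rnorm (T z) <= c * rnorm z) ->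
  series (fun n => dot (T ((val u).1 n)) ((val u).2 n)) @ \oo -->
    normal_functional u T /\
  forall N, rnorm (normal_functional u T -
      series (fun n => dot (T ((val u).1 n)) ((val u).2 n)) N) <=
    c * (limn (series (sq_norms u)) - series (sq_norms u) N).
Proof.
move=> c0 Tc.
have [l [al lN]] := @dominated_series_cvg _ _ (sq_norms u) c _ c0
  (fun n => rnorm_dot_sq_norms _ _ c0 Tc) (@sq_norms_cvg u).
by have -> : normal_functional u T = l by apply: cvg_lim.
Qed.

Lemma normal_functional_cvg u T :
  series (fun n => dot (T ((val u).1 n)) ((val u).2 n)) @ \oo -->
    normal_functional u T.
Proof.
by have [c c0 Tc] := bop_bound T; have [] := normal_functional_approx u (ltW c0) Tc.
Qed.

Lemma normal_functionalP u (a : R[i]) S T :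
  normal_functional u (a *: S + T) = a * normal_functional u S + normal_functional u T.
Proof.
apply: cvg_lim => //.
rewrite (_ : series _ = fun N =>
  a * series (fun n => dot (S ((val u).1 n)) ((val u).2 n)) N +
  series (fun n => dot (T ((val u).1 n)) ((val u).2 n)) N); last first.
  apply/funext => N; rewrite /series /= mulr_sumr -big_split /=.
  by apply: eq_bigr => n _; rewrite -dotZl -dotDl.
apply: cvgD; last exact: normal_functional_cvg.
by apply: cvgMr; exact: normal_functional_cvg.
Qed.

Lemma normal_functionalB u S T :
  normal_functional u (S - T) = normal_functional u S - normal_functional u T.
Proof.
by rewrite addrC -scaleN1r normal_functionalP mulN1r addrC.
Qed.

(** Strong continuity of normal functionals on bounded sets: past finitely many
    vectors the tail of the series is uniformly small. *)
Lemma normal_functional_small u (c e : R) : 0 <= c -> 0 < e ->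
  exists (s : seq H) (d : R), 0 < d /\ forall T,
    (forall z, rnorm (T z) <= c * rnorm z) ->
    {in s, forall z, rnorm (T z) <= d} -> rnorm (normal_functional u T) < e.
Proof.
move=> c0 e0; have e20 : 0 < e / 2 by rewrite divr_gt0.
have /cvgrPdist_lt/(_ (e / 2 / (1 + c))) := @sq_norms_cvg u.
case=> [|N _ NP]; first by rewrite divr_gt0// ltr_wpDr.
have small : c * (limn (series (sq_norms u)) - series (sq_norms u) N) < e / 2.
  have := NP N (leqnn _) => /= /ltr_normlW; rewrite ltr_pdivlMr ?ltr_wpDr// => h.
  have [Pp|Pp] := leP (limn (series (sq_norms u)) - series (sq_norms u) N) 0.
    by apply: le_lt_trans e20; rewrite mulr_ge0_le0.
  by apply: lt_trans h; rewrite mulrC ltr_pM2l// ltrDr.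
pose B := \sum_(n < N) rnorm ((val u).2 n).
have B0 : 0 <= B by apply: sumr_ge0 => n _; exact: rnorm_ge0.
exists [seq (val u).1 n | n <- iota 0 N], (e / 2 / (1 + B)).
split=> [|T Tc Ts]; first by rewrite divr_gt0// ltr_wpDr.
have [_ /(_ N)] := normal_functional_approx u c0 Tc.
set f := series _ N => fN.
rewrite (le_lt_trans (rnorm_le_dist _ f))// [ltRHS]splitr.
rewrite addrC ltr_leD ?(le_lt_trans fN)//.
rewrite /f /series /= big_mkord (le_trans (rnorm_sum _ _ _))//.
apply: (@le_trans _ _ (\sum_(n < N) e / 2 / (1 + B) * rnorm ((val u).2 n))).
  apply: ler_sum => n _; rewrite (le_trans (rnorm_dot _ _))// ler_wpM2r ?rnorm_ge0//.
  by apply: Ts; apply: map_f; rewrite mem_iota /=.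
rewrite -mulr_sumr -/B mulrAC ler_pdivrMr ?ltr_wpDr// ler_wpM2l ?ltW//.
by rewrite ltrDr.
Qed.

End NormalFunctional.

Lemma ptws_cvgP (U : Type) (V : topologicalType) (F : set_system {ptws U -> V})
    (f : {ptws U -> V}) : Filter F ->
  F --> f <-> forall t, (fun g : {ptws U -> V} => g t) @ F --> f t.
Proof.
move=> FF; rewrite cvg_sup; split=> + t => /(_ t); rewrite cvg_image.
- apply: cvg_trans => W /=; rewrite ?nbhs_simpl /fmap /= => [[W' + <-]].
  by apply: filterS => g W'g /=; exists g.
- by rewrite eqEsubset; split=> v // _; exists (fun=> v).
- move=> + W //=; rewrite ?nbhs_simpl => Q => /Q Q'; exists (@^~ t @^-1` W) => //.
  by rewrite eqEsubset; split => [j [? + <-//]|j Wj]; exists (fun _ => j).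
- by rewrite eqEsubset; split=> v // _; exists (fun=> v).
Qed.

Section WeakStarClosure.
Variable R : realType.
Implicit Types G H K : hilbertType R[i].

Lemma normal_functional_continuous H K (u : normal_index H K) :
  continuous (normal_functional u).
Proof.
move=> T; have : @weak_star_eval _ H K @ T --> weak_star_eval T.
  exact: initial_continuous.
move=> /(@ptws_cvgP _ _ (@weak_star_eval _ H K @ T)) /(_ u); apply.
exact/fmap_filter/nbhs_filter.
Qed.

(** Finitely many normal functionals and a tolerance determine a basic
    neighbourhood for the initial topology. *)
Lemma weak_star_closureP H K (A : set (bop H K)) (T : bop H K) :
  closure A T <-> forall n (u : 'I_n -> normal_index H K) (e : R), 0 < e ->
    exists2 S, A S & forall i, rnorm (normal_functional (u i) (T - S)) < e.
Proof.
split=> [AT n u e e0|AT B].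
  have [|S [AS Se]] :=
    AT [set S | forall i, rnorm (normal_functional (u i) (T - S)) < e].
    have := @filter_forall _ _ (fun i S => rnorm (normal_functional (u i) (T - S)) < e)
      (nbhs T) (nbhs_filter T); apply => i.
    have /cvgrPdist_lt/(_ e%:C) := @normal_functional_continuous _ _ (u i) T.
    rewrite ltcR => /(_ e0); apply: filterS => S /=.
    by rewrite rnormE ltcR normal_functionalB.
  by exists S.
(* The filter generated by the traces on [A] of the basic neighbourhoods of [T];
   it converges to [T]. *)
pose F : set_system (bop H K) := [set P |
  exists n (u : 'I_n -> normal_index H K) (e : R), 0 < e /\
    forall S, A S ->
      (forall i, rnorm (normal_functional (u i) (T - S)) < e) -> P S].
have FF : Filter F.
  split.
  - have u0 : 'I_0 -> normal_index H K by case.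
    by exists 0%N, u0, 1.
  - move=> P Q [n [u [e [e0 uP]]]] [m [v [d [d0 vQ]]]].
    exists (n + m)%N, (fun i : 'I_(n + m) => match fintype.split i with
      inl j => u j | inr j => v j end), (Num.min e d).
    split=> [|S AS h]; first by rewrite lt_min e0.
    split; [apply: uP => // i|apply: vQ => // i].
      have := h (lshift m i); rewrite (unsplitK (inl i)) => /lt_le_trans; apply.
      by rewrite ge_min lexx.
    have := h (rshift n i); rewrite (unsplitK (inr i)) => /lt_le_trans; apply.
    by rewrite ge_min lexx orbT.
  - move=> P Q PQ [n [u [e [e0 uP]]]]; exists n, u, e; split=> // S AS h.
    exact/PQ/uP.
have FT : F --> T.
  have : @weak_star_eval _ H K @ F --> weak_star_eval T.
    apply/ptws_cvgP => u; apply/cvgrPdist_lt => e e0.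
    have eE : e = (complex.Re e)%:C by rewrite RRe_real// gtr0_real.
    exists 1%N, (fun=> u), (complex.Re e); split; first by rewrite -ltcR -eE.
    move=> S _ /(_ ord0) /=.
    by rewrite rnormE [X in _ -> is_true (_ < X)]eE ltcR normal_functionalB.
  move=> evF P; rewrite (@nbhsE (initial_topology (@weak_star_eval _ H K))).
  move=> [_ [[B' oB' <-] BT] BP].
  have /evF : nbhs (weak_star_eval T) B' by apply: open_nbhs_nbhs.
  exact: (@filterS _ F FF) (fun S => BP S).
move=> /FT[n [u [e [e0 uB]]]].
have [S AS Se] := AT n u e e0.
by exists S; split=> //; exact: uB.
Qed.

End WeakStarClosure.

Section ClosureProperties.
Variable R : realType.
Implicit Types G H K : hilbertType R[i].

Lemma closure_linear_subspace H K (A : set (bop H K)) :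
  linear_subspace A -> linear_subspace (closure A).
Proof.
move=> [A0 Alin]; split; first exact: subset_closure.
move=> a S T /weak_star_closureP AS /weak_star_closureP AT.
apply/weak_star_closureP => n u e e0.
have d0 : 0 < e / (1 + rnorm a) by rewrite divr_gt0// ltr_wpDr ?rnorm_ge0.
have dE : e / (1 + rnorm a) * (1 + rnorm a) = e.
  by rewrite divfK// gt_eqF// ltr_wpDr ?rnorm_ge0.
have [S' AS' SS'] := AS n u _ d0; have [T' AT' TT'] := AT n u _ d0.
exists (a *: S' + T'); first exact: Alin.
move=> i; have -> : a *: S + T - (a *: S' + T') = a *: (S - S') + (T - T').
  by rewrite scalerBr opprD addrACA.
rewrite normal_functionalP (le_lt_trans (rnormD _ _))// rnormM.
rewrite -[ltRHS]dE mulrDr mulr1 addrC ltr_leD//.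
by rewrite mulrC ler_wpM2r ?rnorm_ge0// ltW.
Qed.

Lemma square_summable_bop H K (f : bop H K) (w : nat -> H) :
  square_summable w -> square_summable (f \o w).
Proof.
move=> /square_summableP wc; apply/square_summableP.
have [c c0 fc] := bop_bound f.
apply: (@series_le_cvg _ _ (fun n => c ^+ 2 * rnorm (w n) ^+ 2)).
- by move=> n; exact: sqr_ge0.
- by move=> n; rewrite mulr_ge0 ?sqr_ge0.
- move=> n; rewrite -exprMn ler_sqr ?nnegrE ?rnorm_ge0//; first exact: fc.
  by rewrite mulr_ge0 ?rnorm_ge0 ?(ltW c0).
rewrite (_ : series _ = fun N => c ^+ 2 * series (fun n => rnorm (w n) ^+ 2) N).
  exact: is_cvgMr.
by apply/funext => N; rewrite /series /= mulr_sumr.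
Qed.

Lemma normal_functional_comp G H K L (a : bop K L) (b : bop G H)
    (u : normal_index G L) :
  exists u' : normal_index H K, forall T,
    normal_functional u (bop_comp a (bop_comp T b)) = normal_functional u' T.
Proof.
have [u1 u2] := set_valP u.
have u'P : (b \o (val u).1, adjoint a \o (val u).2) \in normal_index H K.
  apply/mem_set; split; first exact: (@square_summable_bop _ _ b _ u1).
  exact: (@square_summable_bop _ _ (adjoint a) _ u2).
exists (exist (fun w => w \in normal_index H K) _ u'P) => T; rewrite /normal_functional.
have -> : (fun n => dot (bop_comp a (bop_comp T b) ((val u).1 n)) ((val u).2 n)) =
    (fun n => dot (T (b ((val u).1 n))) (adjoint a ((val u).2 n))).
  by apply/funext => n; rewrite -adjointP.
by [].
Qed.

(** Composition is separately weak* continuous, since [T |-> phi (a T b)] is a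
    normal functional when [phi] is one. *)
Lemma closure_comp G H K L (a : bop K L) (b : bop G H) (A : set (bop H K))
    (B : set (bop G L)) :
  (forall T : bop H K, A T -> closure B (bop_comp a (bop_comp T b))) ->
  forall T : bop H K, closure A T -> closure B (bop_comp a (bop_comp T b)).
Proof.
move=> AB T /weak_star_closureP AT.
rewrite ((closure_id (closure B)).1 (@closed_closure _ B)).
apply/weak_star_closureP => n u e e0.
have /choice[u' u'P] i := normal_functional_comp a b (u i).
have [S AS TS] := AT n u' e e0.
exists (bop_comp a (bop_comp S b)); first exact: AB.
move=> i; rewrite (_ : _ - _ = bop_comp a (bop_comp (T - S) b)) ?u'P//.
apply: bop_eq => x; rewrite [RHS]/=.
by rewrite -[RHS]/(a ((T : bop H K) (b x) - (S : bop H K) (b x))) bopB.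
Qed.

(** On bounded sets the strong topology is finer than the weak* one; closures
    only have to be tested against bounded strong approximations. *)
Lemma strong_closure H K (A : set (bop H K)) (T : bop H K) (c : R) : 0 <= c ->
  (forall (s : seq H) (d : R), 0 < d -> exists S, [/\ A S,
    forall z, rnorm ((T - S : bop H K) z) <= c * rnorm z &
    {in s, forall z, rnorm ((T - S : bop H K) z) <= d}]) ->
  closure A T.
Proof.
move=> c0 AT; apply/weak_star_closureP => n u e e0.
have /choice[sd sdP] i : exists sd : seq H * R, 0 < sd.2 /\ forall T : bop H K,
    (forall z, rnorm (T z) <= c * rnorm z) ->
    {in sd.1, forall z, rnorm (T z) <= sd.2} -> rnorm (normal_functional (u i) T) < e.
  by have [s [d [d0 sdP]]] := normal_functional_small (u i) c0 e0; exists (s, d).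
pose d := \big[Num.min/1]_i (sd i).2.
have d0 : 0 < d.
  rewrite /d; elim/big_ind: _ => //= [x y x0 y0|i _]; first by rewrite lt_min x0.
  exact: (sdP i).1.
have [S [AS Sc Sd]] := AT (flatten [seq (sd i).1 | i <- enum 'I_n]) _ d0.
exists S => // i; apply: (sdP i).2 => // z zi.
apply: (@le_trans _ _ d); last by rewrite /d bigmin_le_cond.
by apply: Sd; apply/flatten_mapP; exists i => //; rewrite mem_enum.
Qed.

End ClosureProperties.

(** * Quantum relations through intertwiners *)

Section Intertwiners.
Variables (R : realType) (K : hilbertType R[i]) (N : set (bop K K)).
Implicit Types (H L : hilbertType R[i]).

(** The operators [y' (1 (x) <xi|)] with [y'] in the commutant are of this kind,
    and span a weak* dense subspace. *)
Definition intertwiners L (T : hilbert_tensor K L) : set (bop T K) :=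
  [set s | forall y, N y -> bop_comp s (ampliation T y) = bop_comp y s].

Definition tensor_intertwiners L L' (T : hilbert_tensor K L)
    (T' : hilbert_tensor K L') : set (bop T T') :=
  [set u | forall y, N y ->
    bop_comp u (ampliation T y) = bop_comp (ampliation T' y) u].

Arguments intertwiners {L} T.
Arguments tensor_intertwiners {L L'} T T'.

Lemma slice_intertwiner L (T : hilbert_tensor K L) l : intertwiners T (slice T l).
Proof. by move=> y _; exact: slice_ampliation. Qed.

Lemma commutant_intertwiner L (T : hilbert_tensor K L) y' s :
  commutant N y' -> intertwiners T s -> intertwiners T (bop_comp y' s).
Proof.
move=> Ny' Ts y Ny; rewrite -bop_compA Ts// bop_compA (Ny' _ Ny).
by rewrite bop_compA.
Qed.

Lemma intertwiner_comp L L' (T : hilbert_tensor K L) (T' : hilbert_tensor K L') s u :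
  intertwiners T' s -> tensor_intertwiners T T' u -> intertwiners T (bop_comp s u).
Proof.
by move=> Ts Tu y Ny; rewrite -bop_compA Tu// bop_compA Ts// bop_compA.
Qed.

Lemma intertwiners_linear L (T : hilbert_tensor K L) : linear_subspace (intertwiners T).
Proof.
split=> [y _|a s t Ts Tt y Ny].
  by apply: bop_eq => x /=; rewrite -[LHS]/(0 : K) -[RHS]/(y (0 : K)) linear0.
apply: bop_eq => x.
rewrite -[LHS]/(a *: (s : bop T K) (ampliation T y x) +
  (t : bop T K) (ampliation T y x)).
rewrite -[RHS]/(y (a *: (s : bop T K) x + (t : bop T K) x)) bopD bopZ.
have /(congr1 (fun f : bop T K => f x)) /= -> := Ts y Ny.
by have /(congr1 (fun f : bop T K => f x)) /= -> := Tt y Ny.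
Qed.

Definition intertwined H L (T : hilbert_tensor K L) (v : bop H T) : set (bop H K) :=
  [set bop_comp s v | s in intertwiners T].

Lemma intertwined_linear H L (T : hilbert_tensor K L) (v : bop H T) :
  linear_subspace (intertwined v).
Proof.
have [T0 Tlin] := intertwiners_linear T; split; first by exists 0 => //; exact: bop_eq.
move=> a _ _ [s Ts <-] [t Tt <-]; exists (a *: s + t); first exact: Tlin.
exact: bop_compPl.
Qed.

Hypothesis vnN : von_neumann_algebra N.

Lemma tensor_intertwiner_adjoint L L' (T : hilbert_tensor K L)
    (T' : hilbert_tensor K L') u :
  tensor_intertwiners T T' u -> tensor_intertwiners T' T (adjoint u).
Proof.
move=> Tu y Ny; have := Tu _ (vn_adjoint vnN Ny).
rewrite !ampliation_adjoint => /(congr1 (@adjoint _ _ _)).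
by rewrite !adjoint_comp !adjointK.
Qed.

(** Compression by [slice_proj t] replaces the intertwiner [s] by the finite sum
    of the [(s (1 (x) |e>)) (1 (x) <e|)], whose left factors commute with [N]. *)
Lemma quantum_relationE H (theta : bop K K -> bop H H) (D : dilation N theta) :
  quantum_relation D = closure (intertwined (dil_op D)).
Proof.
apply/seteqP; split.
  apply: closureS; apply: lin_sub; first exact: intertwined_linear.
  move=> _ [y' Ny' [l _ <-]]; exists (bop_comp y' (slice (dil_tensor D) l)).
    apply: commutant_intertwiner => //; exact: slice_intertwiner.
  by rewrite bop_compA.
rewrite [X in _ `<=` X](closure_id _).1; last exact: closed_closure.
apply: closureS => _ [s Ts <-].
have [a a0 sa] := bop_bound s; have [b b0 vb] := bop_bound (dil_op D).
apply: (@strong_closure _ _ _ _ _ (a * b)) => [|f d d0].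
  by rewrite mulr_ge0// ltW.
have [|t [ot ft]] := @slice_proj_approx _ _ _ (dil_tensor D) [::]
    [seq dil_op D x | x <- f] (d / a) _ (divr_gt0 d0 a0).
  by apply/orthonormalP; split.
rewrite cats0 in ot ft.
exists (bop_comp s (bop_comp (slice_proj (dil_tensor D) t) (dil_op D))).
have TE z : (bop_comp s (dil_op D) -
    bop_comp s (bop_comp (slice_proj (dil_tensor D) t) (dil_op D)) : bop H K) z =
    s (dil_op D z - slice_proj (dil_tensor D) t (dil_op D z)) by rewrite bopB.
split.
- pose W : set (bop H K) := lin
    [set bop_comp y' (bop_comp (slice (dil_tensor D) xi) (dil_op D))
    | y' in commutant N & xi in [set: dil_space D]].
  suff : W (\sum_(e <- t) bop_comp (bop_comp s (ket (dil_tensor D) e))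
      (bop_comp (slice (dil_tensor D) e) (dil_op D))).
    rewrite (_ : \sum_(e <- t) _ =
      bop_comp s (bop_comp (slice_proj (dil_tensor D) t) (dil_op D)))//.
    by apply: bop_eq => x; rewrite bop_sumE /= bop_sumE bop_sum.
  apply: subspace_sum; first exact: subspace_linS.
  move=> e _; apply: sub_lin.
  exists (bop_comp s (ket (dil_tensor D) e)); last by exists e.
  move=> y Ny; apply: bop_eq => x /=; rewrite -ketE -ampliation_ket.
  by have /(congr1 (fun f : bop _ _ => f (ket (dil_tensor D) e x))) /= -> := Ts y Ny.
- move=> z; rewrite TE (le_trans (sa _))// -mulrA ler_wpM2l ?(ltW a0)//.
  by rewrite (le_trans (slice_projC_le _ ot)).
- move=> z zf; rewrite TE (le_trans (sa _))// mulrC -ler_pdivlMr// ltW// ft//.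
  exact: map_f.
Qed.

(** The Gram matrix of the vectors [(x (x) 1) v h] depends only on [theta]: this
    is why different dilations can be compared. *)
Lemma dot_dilation H (theta : bop K K -> bop H H) (D : dilation N theta) x y h h' :
  N x -> N y ->
  dot (ampliation (dil_tensor D) x (dil_op D h))
      (ampliation (dil_tensor D) y (dil_op D h')) =
  dot (theta (bop_comp (adjoint y) x) h) h'.
Proof.
move=> Nx Ny; rewrite (@dilationE _ _ _ _ _ D); last first.
  by apply: vn_comp => //; exact: vn_adjoint.
by rewrite /= -adjointPr ampliation_comp ampliation_adjoint /= -adjointPr.
Qed.

(** The family of pairs [((x (x) 1) v, (x (x) 1) w)], for [x] in [N], is stable
    under the action of [N], which makes the extension an intertwiner; taking
    the identity for [x] shows that [w] factors through [v]. *)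
Lemma intertwiner_extension H L L' (T : hilbert_tensor K L) (T' : hilbert_tensor K L')
    (v : bop H T) (w : bop H T') (c : R) : 0 <= c ->
  (forall n (x : 'I_n -> bop K K) (h : 'I_n -> H), (forall i, N (x i)) ->
    rnorm (\sum_i ampliation T' (x i) (w (h i))) <=
    c * rnorm (\sum_i ampliation T (x i) (v (h i)))) ->
  exists u : bop T T', [/\ tensor_intertwiners T T' u,
    forall x h, N x -> u (ampliation T x (v h)) = ampliation T' x (w h) &
    forall z, (forall x h, N x -> dot z (ampliation T x (v h)) = 0) -> u z = 0].
Proof.
move=> c0 vw.
pose Om : set (bop H T * bop H T') :=
  [set (bop_comp (ampliation T x) v, bop_comp (ampliation T' x) w) | x in N].
have [n B h OmB|u [uOm u0 uint]] := @extend_family _ _ _ _ Om c c0.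
  have /choice[x xP] i : exists x, N x /\
      B i = (bop_comp (ampliation T x) v, bop_comp (ampliation T' x) w).
    by have [x Nx <-] := OmB i; exists x.
  under eq_bigr do rewrite (xP _).2.
  under [X in _ <= _ * rnorm X]eq_bigr do rewrite (xP _).2.
  by apply: vw => i; exact: (xP i).1.
exists u; split.
- move=> y Ny; apply: bop_eq => z; apply: uint.
    move=> _ [x Nx <-] /=; exists (bop_comp y x); first exact: vn_comp.
    by rewrite !ampliation_comp -!bop_compA.
  move=> _ [x Nx <-] /=; exists (bop_comp (ampliation T' (bop_comp (adjoint y) x)) w).
  exists (bop_comp (adjoint y) x); first by apply: vn_comp => //; exact: vn_adjoint.
  by rewrite !ampliation_comp ampliation_adjoint -!bop_compA.
- move=> x h Nx.
  apply: (uOm (bop_comp (ampliation T x) v, bop_comp (ampliation T' x) w)).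
  by exists x.
- by move=> z zv; apply: u0 => _ h [x Nx <-]; exact: zv.
Qed.

End Intertwiners.
Arguments intertwiners {R K} N {L} T.
Arguments tensor_intertwiners {R K} N {L L'} T T'.
Arguments intertwined {R K} N {H L T} v.

(** * Families of operators with contractive Gram sum *)

Section GramSum.
Variables (R : realType) (X Y : hilbertType R[i]) (I : eqType).
Variables (t : seq I) (u : I -> bop X Y).

Definition gram_sum : bop X X := \sum_(e <- t) bop_comp (adjoint (u e)) (u e).

Lemma gram_sumE z z' : dot (gram_sum z) z' = \sum_(e <- t) dot (u e z) (u e z').
Proof.
by rewrite bop_sumE dot_suml; apply: eq_bigr => e _; rewrite /= -adjointPr.
Qed.

Lemma gram_sum_self z : dot (gram_sum z) z = (\sum_(e <- t) rnorm (u e z) ^+ 2)%:C.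
Proof.
by rewrite gram_sumE rmorph_sum; apply: eq_bigr => e _; rewrite /= dot_self.
Qed.

(** This is [(1 - A)^2 <= 1 - A] for [A] the [gram_sum], which the hypothesis
    places between [0] and [1]. *)
Lemma gram_sum_defect :
  (forall z, \sum_(e <- t) rnorm (u e z) ^+ 2 <= rnorm z ^+ 2) ->
  forall z, rnorm (z - gram_sum z) ^+ 2 <=
    rnorm z ^+ 2 - \sum_(e <- t) rnorm (u e z) ^+ 2.
Proof.
move=> ule z; set f := fun z => \sum_(e <- t) rnorm (u e z) ^+ 2.
(* [|A z|^2] is the sum of the [(u e z|u e (A z))]; half of [f (A z) <= |A z|^2]
   is absorbed on the left. *)
have Az : rnorm (gram_sum z) ^+ 2 <= f z.
  suff : rnorm (gram_sum z) ^+ 2 <= (f z + f (gram_sum z)) / 2.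
    by have := ule (gram_sum z); rewrite -/(f _) => h1 h2; lra.
  rewrite -[X in X <= _]ger0_norm ?sqr_ge0// -rnorm_real -dot_self gram_sumE.
  rewrite (le_trans (rnorm_sum _ _ _))// /f -big_split /= mulr_suml.
  apply: ler_sum => e _; rewrite (le_trans (rnorm_dot _ _))//.
  have := sqr_ge0 (rnorm (u e z) - rnorm (u e (gram_sum z))).
  by rewrite sqrrB; move: (rnorm _ * rnorm _) => p; rewrite -mulr_natr; lra.
have -> : rnorm (z - gram_sum z) ^+ 2 =
    rnorm z ^+ 2 - f z - f z + rnorm (gram_sum z) ^+ 2.
  apply: complexI; rewrite rmorphD !rmorphB /= -!dot_self dotBl !dotBr gram_sum_self.
  have -> : dot z (gram_sum z) = (f z)%:C by rewrite dotC gram_sum_self conjC_rc.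
  by rewrite opprB addrA addrAC.
by rewrite -/(f z) -lerBrDl; lra.
Qed.

(** A quadratic inequality valid on a subspace extends to its closure by
    continuity, and to the whole space when the [u e] vanish on its orthogonal
    complement. *)
Lemma gram_sum_contraction (E : set X) : linear_subspace E ->
  (forall z, E z -> \sum_(e <- t) rnorm (u e z) ^+ 2 <= rnorm z ^+ 2) ->
  (forall e z, e \in t -> (forall z', E z' -> dot z z' = 0) -> u e z = 0) ->
  forall z, \sum_(e <- t) rnorm (u e z) ^+ 2 <= rnorm z ^+ 2.
Proof.
move=> sE uE u0 z; have [p [pE zp]] := orthogonal_projection z sE.
have pz : rnorm p <= rnorm z by apply: rnorm_projection_le; exact: adherent_orth pE zp.
have -> : \sum_(e <- t) rnorm (u e z) ^+ 2 = \sum_(e <- t) rnorm (u e p) ^+ 2.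
  apply: eq_big_seq => e et; congr (rnorm _ ^+ 2); apply/subr0_eq.
  by rewrite -bopB; exact: u0.
apply: (@le_trans _ _ (rnorm p ^+ 2)); last by rewrite ler_sqr ?nnegrE ?rnorm_ge0.
pose A : bop X X := bop_id X - gram_sum.
have AE z1 : A z1 = z1 - gram_sum z1 by [].
have Aself z1 : dot (A z1) z1 = (rnorm z1 ^+ 2 - \sum_(e <- t) rnorm (u e z1) ^+ 2)%:C.
  by rewrite AE dotBl gram_sum_self dot_self rmorphB.
have [c c0 Ac] := bop_bound A.
apply/ler_addgt0Pr => e e0.
(* For [|p - y| < d <= 1], the values at [p] and [y] of the quadratic form of [A]
   differ by at most [c * d * (2 * |p| + 1)]. *)
pose d := Num.min 1 (e / (c * (rnorm p + rnorm p + 1))).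
have C0 : 0 < c * (rnorm p + rnorm p + 1).
  by rewrite mulr_gt0// ltr_wpDl// addr_ge0 ?rnorm_ge0.
have d0 : 0 < d by rewrite lt_min ltr01 divr_gt0.
have [y Ey py] := pE d d0.
have := uE y Ey; rewrite -subr_ge0 => h.
suff : rnorm (dot (A p) p - dot (A y) y) <= e.
  have := le_trans (ler_norm _) (norm_Re_le_rnorm (dot (A y) y - dot (A p) p)).
  by rewrite rnormB raddfB /= !Aself /= => h1 h2; lra.
have -> : dot (A p) p - dot (A y) y = dot (A (p - y)) p + dot (A y) (p - y).
  by rewrite bopB dotBl dotBr addrA subrK.
have py1 : rnorm (p - y) < 1 by rewrite (lt_le_trans py)// ge_min lexx.
have pye : rnorm (p - y) * (c * (rnorm p + rnorm p + 1)) <= e.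
  by rewrite -ler_pdivlMr// (le_trans (ltW py))// ge_min lexx orbT.
have yp : rnorm y <= rnorm p + 1.
  by rewrite (le_trans (rnorm_le_dist y p))// lerD2l rnormB ltW.
rewrite (le_trans (rnormD _ _))//; apply: le_trans pye.
have h1 := le_trans (rnorm_dot (A (p - y)) p) (ler_wpM2r (rnorm_ge0 p) (Ac (p - y))).
have h2 := le_trans (rnorm_dot (A y) (p - y)) (ler_wpM2r (rnorm_ge0 _) (Ac y)).
have h3 : c * rnorm y * rnorm (p - y) <= c * (rnorm p + 1) * rnorm (p - y).
  by rewrite ler_wpM2r ?rnorm_ge0// ler_wpM2l// ltW.
rewrite (le_trans (lerD h1 (le_trans h2 h3)))// le_eqVlt; apply/orP; left; apply/eqP.
ring.
Qed.

End GramSum.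

(** * Composition of dilations *)

Section Composition.
Variables (R : realType) (H1 H2 H3 : hilbertType R[i]).
Variables (M1 : set (bop H1 H1)) (M2 : set (bop H2 H2)).
Variables (theta1 : bop H1 H1 -> bop H2 H2) (theta2 : bop H2 H2 -> bop H3 H3).
Hypotheses (vnM1 : von_neumann_algebra M1).
Hypothesis theta1M : forall y, M1 y -> M2 (theta1 y).
Variables (D1 : dilation M1 theta1) (D2 : dilation M2 theta2).
Variable D : dilation M1 (theta2 \o theta1).
Local Notation T1 := (dil_tensor D1).
Local Notation T2 := (dil_tensor D2).
Local Notation T := (dil_tensor D).
Local Notation v1 := (dil_op D1).
Local Notation v2 := (dil_op D2).
Local Notation v := (dil_op D).

(** The commutant of [M2] acts on the [M1]-module generated by [v1] since
    [theta1] takes its values in [M2]. *)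
Lemma commutant_lift y' : commutant M2 y' ->
  exists2 r, tensor_intertwiners M1 T1 T1 r & bop_comp r v1 = bop_comp v1 y'.
Proof.
move=> My'; have [c c0 yc] := bop_bound y'.
have [n x h Mx|r [Tr rv _]] := @intertwiner_extension _ _ _ vnM1 _ _ _ T1 T1
    v1 (bop_comp v1 y') c (ltW c0).
  apply: (@commuting_bound _ _ _ _
    (fun i => bop_comp (ampliation T1 (x i)) v1) y' c) => //.
  move=> i j k k' /=; rewrite !dot_dilation// -adjointP.
  have Mth : M2 (theta1 (bop_comp (adjoint (x j)) (x i))).
    by apply: theta1M; apply: vn_comp => //; exact: vn_adjoint.
  by have /(congr1 (fun f : bop _ _ => f k)) /= <- := My' _ Mth.
exists r => //; apply: bop_eq => h /=.
by have := rv _ h (vn_id vnM1); rewrite !ampliation_id.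
Qed.

Section Frame.
Variables (n : nat) (x : 'I_n -> bop H1 H1) (h : 'I_n -> H3).
Hypothesis Mx : forall i, M1 (x i).

(** A vector of the [M1]-module generated by the range of [v]; its norm is
    determined by [theta2 \o theta1]. *)
Definition module_vector : T := \sum_i ampliation T (x i) (v (h i)).

(** The image of [module_vector] under the operator [u_e] sought. *)
Definition module_slice e : T1 :=
  \sum_i ampliation T1 (x i) (v1 (slice T2 e (v2 (h i)))).

Let A i j := theta1 (bop_comp (adjoint (x j)) (x i)).

Let MA i j : M2 (A i j).
Proof. by apply: theta1M; apply: vn_comp => //; exact: vn_adjoint. Qed.

Lemma module_vector_gram : (rnorm module_vector ^+ 2)%:C =
  \sum_i \sum_j dot (ampliation T2 (A i j) (v2 (h i))) (v2 (h j)).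
Proof.
rewrite -dot_self dot_suml; apply: eq_bigr => i _; rewrite dot_sumr.
apply: eq_bigr => j _; rewrite dot_dilation//= (@dilationE _ _ _ _ _ D2); last exact: MA.
by rewrite /= -adjointPr.
Qed.

(** The slices over [t] assemble the compression of the Gram matrix of
    [module_vector] by [slice_proj t]: slices intertwine the ampliations of the
    [A i j], whose dilation by [v1] yields the norms on the left. *)
Lemma module_slice_gram t : (\sum_(e <- t) rnorm (module_slice e) ^+ 2)%:C =
  \sum_i \sum_j dot (ampliation T2 (A i j) (v2 (h i))) (slice_proj T2 t (v2 (h j))).
Proof.
rewrite rmorph_sum /=.
transitivity (\sum_(e <- t) \sum_i \sum_j
    dot (A i j (slice T2 e (v2 (h i)))) (slice T2 e (v2 (h j)))).
  apply: eq_bigr => e _; rewrite -dot_self dot_suml; apply: eq_bigr => i _.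
  by rewrite dot_sumr; apply: eq_bigr => j _; rewrite dot_dilation.
rewrite exchange_big; apply: eq_bigr => i _; rewrite exchange_big.
apply: eq_bigr => j _; rewrite slice_projE dot_slice_proj; apply: eq_bigr => e _.
have := slice_ampliation T2 (A i j) e.
by move=> /(congr1 (fun f : bop _ _ => f (v2 (h i)))) /= ->.
Qed.

Lemma module_defect t :
  `|rnorm module_vector ^+ 2 - \sum_(e <- t) rnorm (module_slice e) ^+ 2| <=
  \sum_i \sum_j rnorm (ampliation T2 (A i j) (v2 (h i))) *
    rnorm (v2 (h j) - slice_proj T2 t (v2 (h j))).
Proof.
rewrite -rnorm_real rmorphB /= module_vector_gram module_slice_gram -sumrB.
rewrite (le_trans (rnorm_sum _ _ _))// ler_sum// => i _.
rewrite -sumrB (le_trans (rnorm_sum _ _ _))// ler_sum// => j _.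
by rewrite -dotBr rnorm_dot.
Qed.

(** The sums over orthonormal families increase with the family and tend to the
    right-hand side. *)
Lemma module_slice_le t : orthonormal dot t ->
  \sum_(e <- t) rnorm (module_slice e) ^+ 2 <= rnorm module_vector ^+ 2.
Proof.
move=> ot; apply/ler_addgt0Pr => d d0.
pose B := \sum_i \sum_j rnorm (ampliation T2 (A i j) (v2 (h i))).
have B0 : 0 <= B by do 2 (apply: sumr_ge0 => ? _); exact: rnorm_ge0.
have d1 : 0 < d / (1 + B) by rewrite divr_gt0// ltr_wpDr.
have [t' [ot' t'P]] := slice_proj_approx [seq v2 (h j) | j <- enum 'I_n] ot d1.
have := module_defect (t' ++ t); set S := \sum_i _ => defect.
have SB : S <= d.
  apply: (@le_trans _ _ (B * (d / (1 + B)))).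
    rewrite mulr_suml ler_sum// => i _; rewrite mulr_suml ler_sum// => j _.
    rewrite ler_wpM2l ?rnorm_ge0// ltW// t'P//; apply: map_f.
    by rewrite mem_enum.
  rewrite mulrCA ler_piMr ?(ltW d0)// ler_pdivrMr ?ltr_wpDr// mul1r.
  by rewrite lerDr.
apply: (@le_trans _ _ (\sum_(e <- t' ++ t) rnorm (module_slice e) ^+ 2)).
  by rewrite big_cat /= lerDr; apply: sumr_ge0 => e _; exact: sqr_ge0.
have := le_trans defect SB; rewrite ler_norml => /andP[h1 _]; lra.
Qed.

End Frame.

(** The case of a single vector, after normalization. *)
Lemma module_slice_bound n (x : 'I_n -> bop H1 H1) (h : 'I_n -> H3) e :
  (forall i, M1 (x i)) ->
  rnorm (module_slice x h e) <= rnorm e * rnorm (module_vector x h).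
Proof.
move=> Mx; have sliceZ (a : R[i]) e' z : slice T2 (a *: e') z = a^* *: slice T2 e' z.
  rewrite !slice_adj; apply: dot_inj => k.
  by rewrite dotZl -!adjointPr !ketE linearZr_LR dotZr.
have [->|e0] := eqVneq e 0.
  rewrite /module_slice big1 ?rnorm0 ?mul0r// => i _.
  by rewrite -(scale0r e) sliceZ conjC0 scale0r !linear0.
have ne := rnorm_gt0 e0.
pose f := ((rnorm e)^-1)%:C *: e.
have eE : e = (rnorm e)%:C *: f by rewrite scalerA -rmorphM /= divff ?gt_eqF// scale1r.
have of1 : orthonormal dot [:: f].
  apply/orthonormalP; split=> // a b; rewrite !inE => /eqP -> /eqP ->.
  rewrite eqxx dot_self rnormZ rnorm_real ger0_norm ?invr_ge0 ?(ltW ne)//.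
  by rewrite mulVf ?gt_eqF// expr1n.
have -> : module_slice x h e = (rnorm e)%:C *: module_slice x h f.
  rewrite [in LHS]eE /module_slice scaler_sumr; apply: eq_bigr => i _.
  by rewrite sliceZ conjC_rc !bopZ.
rewrite rnormZ rnorm_real ger0_norm ?(ltW ne)// ler_wpM2l ?(ltW ne)//.
rewrite -ler_sqr ?nnegrE ?rnorm_ge0//.
by have := module_slice_le h Mx of1; rewrite big_seq1.
Qed.

Lemma slice_factor e : exists u : bop T T1, [/\ tensor_intertwiners M1 T T1 u,
  forall x h, M1 x ->
    u (ampliation T x (v h)) = ampliation T1 x (v1 (slice T2 e (v2 h))) &
  forall z, (forall x h, M1 x -> dot z (ampliation T x (v h)) = 0) -> u z = 0].
Proof.
apply: (@intertwiner_extension _ _ _ vnM1 _ _ _ T T1 v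
  (bop_comp v1 (bop_comp (slice T2 e) v2)) (rnorm e) (rnorm_ge0 e)).
by move=> n x h Mx; exact: module_slice_bound.
Qed.

(** The generators of the composition are [(s r u_e) v]. *)
Lemma intertwined_commutant_slice s y' e :
  intertwiners M1 T1 s -> commutant M2 y' ->
  intertwined M1 v
    (bop_comp (bop_comp s v1) (bop_comp y' (bop_comp (slice T2 e) v2))).
Proof.
move=> Ts My'; have [r Tr rv] := commutant_lift My'.
have [u [Tu uv _]] := slice_factor e.
exists (bop_comp (bop_comp s r) u).
  by apply: intertwiner_comp => //; exact: intertwiner_comp.
apply: bop_eq => h /=.
have := uv _ h (vn_id vnM1); rewrite !ampliation_id /= => ->.
by have /(congr1 (fun f : bop _ _ => f (slice T2 e (v2 h)))) /= -> := rv.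
Qed.

(** Separate weak* continuity of the composition reduces the inclusion first to
    [a = s v1], then to a generator [b] of the second relation. *)
Lemma quantum_comp_sub_closure :
  quantum_comp (quantum_relation D1) (quantum_relation D2) `<=`
  closure (intertwined M1 v).
Proof.
have sI := closure_linear_subspace (intertwined_linear M1 v).
rewrite [X in _ `<=` X]((closure_id _).1 (@closed_closure _ _)).
apply: closureS; apply: lin_sub => // _ [a aV [b bV <-]].
have -> : bop_comp a b = bop_comp (bop_id H1) (bop_comp a b) by exact: bop_eq.
move: a aV; rewrite quantum_relationE//; apply: closure_comp => _ [s Ts <-].
have -> : bop_comp (bop_id H1) (bop_comp (bop_comp s v1) b) =
  bop_comp (bop_comp s v1) (bop_comp b (bop_id H3)) by exact: bop_eq.
move: b bV; apply: closure_comp.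
apply: (@lin_sub _ _ _ [set b : bop H3 H2 |
  closure (intertwined M1 v) (bop_comp (bop_comp s v1) (bop_comp b (bop_id H3)))]).
  split=> [|a f g fI gI] /=.
    rewrite (_ : bop_comp _ _ = 0); first exact: sI.1.
    by apply: bop_eq => z; rewrite -[LHS]/(bop_comp s v1 0) linear0.
  rewrite bop_compPl bop_compPr; exact: sI.2.
move=> _ [y' My' [e _ <-]] /=; apply: subset_closure.
have -> (f : bop H3 H2) : bop_comp f (bop_id H3) = f by exact: bop_eq.
exact: intertwined_commutant_slice.
Qed.

(** [s v] is approximated by [s A v], with [A] the sum of the [u_e^* u_e] over an
    orthonormal family: [|(1 - A) v h|^2] is at most [|v h|^2] minus the sum of
    the [|u_e v h|^2], a defect that [module_defect] bounds by
    [|v2 h - slice_proj t (v2 h)|] up to a factor independent of the family. *)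
Lemma intertwined_sub_quantum_comp :
  intertwined M1 v `<=` quantum_comp (quantum_relation D1) (quantum_relation D2).
Proof.
move=> _ [s Ts <-].
have [a a0 sa] := bop_bound s; have [b b0 vb] := bop_bound v.
have /choice[u uP] := slice_factor.
have Tu e : tensor_intertwiners M1 T T1 (u e) by case: (uP e).
have uv e x h : M1 x ->
    u e (ampliation T x (v h)) = ampliation T1 x (v1 (slice T2 e (v2 h))).
  by case: (uP e) => _ + _; apply.
pose E : set T := lin [set ampliation T x (v h) | x in M1 & h in setT].
have contr t : orthonormal dot t ->
    forall z, \sum_(e <- t) rnorm (u e z) ^+ 2 <= rnorm z ^+ 2.
  move=> ot; apply: (@gram_sum_contraction _ _ _ _ _ _ E).
  - exact: subspace_linS.
  - move=> _ [n [c [w [wE ->]]]].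
    have /choice[xh xhP] i : exists xh : bop H1 H1 * H3,
        M1 xh.1 /\ w i = ampliation T xh.1 (v xh.2).
      by have [x Mx [h _ <-]] := wE i; exists (x, h).
    have -> : \sum_i c i *: w i =
        module_vector (fun i => (xh i).1) (fun i => c i *: (xh i).2).
      by apply: eq_bigr => i _; rewrite (xhP i).2 !bopZ.
    rewrite (le_trans _ (module_slice_le _ _ ot))//; last by move=> i; exact: (xhP i).1.
    apply: ler_sum => e _; rewrite /module_vector bop_sum /module_slice.
    rewrite (eq_bigr _ (fun i _ => uv e _ _ (xhP i).1)).
    exact: lexx.
  - move=> e z _ zE; case: (uP e) => _ _; apply => x h Mx; apply: zE.
    by apply: sub_lin; exists x => //; exists h.
apply: (@strong_closure _ _ _ _ _ (a * b)) => [|f d d0].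
  by rewrite mulr_ge0// ltW.
pose A := theta1 (bop_comp (adjoint (bop_id H1)) (bop_id H1)).
pose C := \sum_(h <- f) rnorm (ampliation T2 A (v2 h)).
have C0 : 0 <= C by apply: sumr_ge0 => h _; exact: rnorm_ge0.
(* The tolerance is squared because the defect bounds a squared norm; [C] absorbs
   the factor in front of [|v2 h - slice_proj t (v2 h)|] for all [h] in [f]. *)
have da : 0 < d / a by rewrite divr_gt0.
have dC : 0 < (d / a) ^+ 2 / (1 + C) by rewrite divr_gt0 ?exprn_gt0// ltr_wpDr.
have [|t [ot ft]] := @slice_proj_approx _ _ _ T2 [::] [seq v2 h | h <- f] _ _ dC.
  by apply/orthonormalP; split.
rewrite cats0 in ot ft.
exists (bop_comp s (bop_comp (gram_sum t u) v)).
have sE z : (bop_comp s v - bop_comp s (bop_comp (gram_sum t u) v) : bop H3 H1) z =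
    s (v z - gram_sum t u (v z)) by rewrite bopB.
have defect := gram_sum_defect (contr t ot).
split.
- pose W : set (bop H3 H1) := lin [set bop_comp f g
    | f in quantum_relation D1 & g in quantum_relation D2].
  suff : W (\sum_(e <- t) bop_comp (bop_comp (bop_comp s (adjoint (u e))) v1)
      (bop_comp (slice T2 e) v2)).
    rewrite (_ : \sum_(e <- t) _ = bop_comp s (bop_comp (gram_sum t u) v))//.
    apply: bop_eq => z; rewrite bop_sumE /= bop_sumE bop_sum; apply: eq_bigr => e _ /=.
    by have := uv e _ z (vn_id vnM1); rewrite !ampliation_id /= => ->.
  apply: subspace_sum; first exact: subspace_linS.
  move=> e _; apply: sub_lin.
  exists (bop_comp (bop_comp s (adjoint (u e))) v1).
    rewrite quantum_relationE//; apply: subset_closure.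
    exists (bop_comp s (adjoint (u e))) => //.
    by apply: intertwiner_comp Ts _; exact: tensor_intertwiner_adjoint.
  exists (bop_comp (slice T2 e) v2) => //.
  rewrite quantum_relationE//; apply: subset_closure.
  by exists (slice T2 e) => //; exact: slice_intertwiner.
- move=> z; rewrite sE (le_trans (sa _))// -mulrA ler_wpM2l ?(ltW a0)//.
  apply: le_trans (vb z); rewrite -ler_sqr ?nnegrE ?rnorm_ge0//.
  rewrite (le_trans (defect _))// gerDl oppr_le0.
  by apply: sumr_ge0 => e _; exact: sqr_ge0.
- move=> z zf; rewrite sE (le_trans (sa _))// mulrC -ler_pdivlMr//.
  rewrite -ler_sqr ?nnegrE ?rnorm_ge0 ?(ltW da)//.
  rewrite (le_trans (defect _))//.
  have := @module_defect 1 (fun=> bop_id H1) (fun=> z) (fun=> vn_id vnM1) t.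
  have -> : module_vector (fun _ : 'I_1 => bop_id H1) (fun=> z) = v z.
    by rewrite /module_vector big_ord1 ampliation_id.
  rewrite (_ : \sum_(e <- t) rnorm (module_slice _ _ _) ^+ 2 =
      \sum_(e <- t) rnorm (u e (v z)) ^+ 2); last first.
    apply: eq_bigr => e _; rewrite /module_slice big_ord1.
    by rewrite -(uv e _ z (vn_id vnM1)) ampliation_id.
  move=> /(le_trans (ler_norm _)) /le_trans; apply.
  rewrite !big_ord1 -/A.
  apply: (@le_trans _ _ (C * ((d / a) ^+ 2 / (1 + C)))).
    apply: ler_pM; rewrite ?rnorm_ge0//.
      by rewrite /C (big_rem z zf)/= lerDl; apply: sumr_ge0 => h _; exact: rnorm_ge0.
    by rewrite ltW// ft//; exact: map_f.
  rewrite mulrCA ler_piMr ?sqr_ge0// ler_pdivrMr ?ltr_wpDr// mul1r.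
  by rewrite lerDr.
Qed.

End Composition.

Theorem proposition4p9 (R : realType) (H1 H2 H3 : hilbertType R[i])
  (M1 : set (bop H1 H1)) (M2 : set (bop H2 H2)) (M3 : set (bop H3 H3))
  (theta1 : bop H1 H1 -> bop H2 H2) (theta2 : bop H2 H2 -> bop H3 H3)
  (vnM1 : von_neumann_algebra M1) (vnM2 : von_neumann_algebra M2)
  (vnM3 : von_neumann_algebra M3)
  (ncp1 : normal_cp_map M1 M2 theta1) (ncp2 : normal_cp_map M2 M3 theta2)
  (D1 : dilation M1 theta1) (D2 : dilation M2 theta2)
  (D : dilation M1 (theta2 \o theta1)) :
  quantum_relation D = quantum_comp (quantum_relation D1) (quantum_relation D2).
Proof.
have theta1M := ncp_maps ncp1.
rewrite (quantum_relationE D); apply/seteqP; split.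
  rewrite [X in _ `<=` X]((closure_id _).1 (@closed_closure _ _)).
  exact/closureS/intertwined_sub_quantum_comp.
exact: quantum_comp_sub_closure.
Qed.
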